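(* Let $\Pi$ be a class of non-empty graphs characterized by $c_\Pi$ adjacencies for some constant $c_\Pi$, and suppose there is a non-decreasing polynomial $p$ such that every vertex-minimal graph $G\in\Pi$ satisfies $|V(G)| \le p(\tau(G))$, where $\tau(G)$ is the size of a minimum vertex cover of $G$. Consider the problem $\Pi$-Free Deletion: given a graph $G$ and $k\in\mathbb{N}$, decide whether there is $S \subseteq V(G)$ with $|S|\le k$ such that $G - S$ has no induced subgraph belonging to $\Pi$. This problem, parameterized by the vertex cover number of the input graph, is in $\textsc{para-L}$.
   Context: A class $\Pi$ of graphs is characterized by $c_\Pi$ adjacencies if for every $G \in \Pi$ and every $v \in V(G)$ there is a set $D \subseteq V(G)\setminus\{v\}$ with $|D|\le c_\Pi$ such that adding or removing any number of edges between $v$ and vertices of $V(G)\setminus D$ yields a graph that is also in $\Pi$. A graph $G\in\Pi$ is vertex-minimal if no proper induced subgraph of $G$ is in $\Pi$. The class $\textsc{para-L}$ consists of all parameterized problems solvable by a deterministic algorithm using $f(k) + O(\log n)$ bits of auxiliary space (input in read-only memory, output to a write-only stream), where $n$ is the input size, $k$ the parameter and $f$ a computable function.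
   Formalization: The formal statement additionally assumes that membership in Π is decidable; without this the claim fails, e.g. for Hamiltonian graphs whose order lies in an undecidable set. *)

(* Defs.v *)
From HB Require Import structures.
From mathcomp Require Import all_boot all_order all_algebra.
Set Implicit Arguments.
Unset Strict Implicit.
Unset Printing Implicit Defensive.

(** * Finite simple graphs and graph classes *)

Record sgraph := SGraph {
  vertex :> finType;
  adj : rel vertex;
  adj_sym : symmetric adj;
  adj_irr : irreflexive adj
}.
Arguments SGraph {vertex} adj adj_sym adj_irr.
Arguments adj {s}.

Lemma induced_sym (G : sgraph) (S : {set G}) :
  symmetric (fun x y : {x : G | x \in S} => adj (val x) (val y)).
Proof. by move=> x y; apply: adj_sym. Qed.

Lemma induced_irr (G : sgraph) (S : {set G}) :
  irreflexive (fun x y : {x : G | x \in S} => adj (val x) (val y)).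
Proof. by move=> x; apply: adj_irr. Qed.

Definition induced (G : sgraph) (S : {set G}) : sgraph :=
  SGraph _ (induced_sym (S := S)) (induced_irr (S := S)).

Definition remove (G : sgraph) (S : {set G}) : sgraph := induced (~: S).

Definition isomorphic (G H : sgraph) : Prop :=
  exists2 h : G -> H, bijective h & forall x y, adj (h x) (h y) = adj x y.

Definition graph_class (Pi : sgraph -> Prop) : Prop :=
  forall G H, isomorphic G H -> Pi G -> Pi H.

(* [e] differs from the adjacency of [G] at most on pairs {v, u}, u \notin D. *)
Definition modifies_at (G : sgraph) (v : G) (D : {set G}) (e : rel G) : Prop :=
  forall x y, e x y != adj x y ->
    (x == v) && (y \notin D) || (y == v) && (x \notin D).

Definition characterized_by_adjacencies (Pi : sgraph -> Prop) (c : nat) : Prop :=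
  forall G, Pi G -> forall v : G,
  exists D : {set G},
    [/\ v \notin D, #|D| <= c
      & forall (e : rel G) (e_sym : symmetric e) (e_irr : irreflexive e),
          modifies_at v D e -> Pi (SGraph e e_sym e_irr)].

Definition vertex_minimal (Pi : sgraph -> Prop) (G : sgraph) : Prop :=
  Pi G /\ forall S : {set G}, S \proper [set: G] -> ~ Pi (induced S).

Definition vertex_cover (G : sgraph) (C : {set G}) : bool :=
  [forall x, forall y, adj x y ==> (x \in C) || (y \in C)].

Definition vc_number (G : sgraph) : nat :=
  #|[arg min_(C < [set: G] | vertex_cover C) #|C| ]|.

Definition free_of (Pi : sgraph -> Prop) (G : sgraph) : Prop :=
  forall S : {set G}, ~ Pi (induced S).

(** * Space-bounded computation *)

(* Number of bits of the binary representation of n (0 for n = 0). *)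
Definition bitsize (n : nat) : nat := up_log 2 n.+1.

(* The model is a register machine with logarithmic cost: a program uses a
   fixed finite number of registers holding natural numbers, and its space
   consumption is the total number of bits stored in them.  The input is a
   read-only bit string with random access.  Every elementary operation runs on
   a Turing machine in space linear in the bit sizes of its operands and result,
   and a work tape can be kept in two registers, so this agrees with Turing
   machine space up to a constant factor. *)

Inductive binop := OpAdd | OpSub | OpMul | OpDiv | OpMod.

Definition binop_sem (o : binop) : nat -> nat -> nat :=
  match o with
  | OpAdd => addn | OpSub => subn | OpMul => muln
  | OpDiv => divn | OpMod => modn
  end.

(* Natural-number arguments other than that of [Const] are register names. *)
Inductive rhs :=
| Const of nat
| Binop of binop & nat & nat
| Input of nat.

Inductive cmd :=
| Skip
| Assign of nat & rhs
| Seq of cmd & cmd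
| If of nat & cmd & cmd
| While of nat & cmd.

(* Registers beyond the end of the sequence contain 0. *)
Definition store := seq nat.
Definition reg (s : store) (x : nat) : nat := nth 0 s x.
Definition space (s : store) : nat := \sum_(v <- s) bitsize v.

(* Reading at an address past the end of the input returns the end marker 2. *)
Definition rhs_sem (w : seq bool) (s : store) (r : rhs) : nat :=
  match r with
  | Const n => n
  | Binop o y z => binop_sem o (reg s y) (reg s z)
  | Input y => nth 2 (map nat_of_bool w) (reg s y)
  end.

(* [exec w B c s s']: on input w, command c started in store s halts in store
   s', and no store produced on the way uses more than B bits. *)
Inductive exec (w : seq bool) (B : nat) : cmd -> store -> store -> Prop :=
| ExecSkip s : exec w B Skip s s
| ExecAssign x r s :
    space (set_nth 0 s x (rhs_sem w s r)) <= B ->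
    exec w B (Assign x r) s (set_nth 0 s x (rhs_sem w s r))
| ExecSeq c1 c2 s1 s2 s3 :
    exec w B c1 s1 s2 -> exec w B c2 s2 s3 -> exec w B (Seq c1 c2) s1 s3
| ExecIfTrue x c1 c2 s s' :
    reg s x != 0 -> exec w B c1 s s' -> exec w B (If x c1 c2) s s'
| ExecIfFalse x c1 c2 s s' :
    reg s x = 0 -> exec w B c2 s s' -> exec w B (If x c1 c2) s s'
| ExecWhileTrue x c s1 s2 s3 :
    reg s1 x != 0 -> exec w B c s1 s2 -> exec w B (While x c) s2 s3 ->
    exec w B (While x c) s1 s3
| ExecWhileFalse x c s :
    reg s x = 0 -> exec w B (While x c) s s.

(* The one-bit answer is read off register 0 (nonzero means yes), all registers
   being 0 at the start. *)
Definition answers (c : cmd) (w : seq bool) (B : nat) (A : Prop) : Prop :=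
  exists2 s, exec w B c [::] s & (reg s 0 != 0 <-> A).

Definition computable (f : nat -> nat) : Prop :=
  exists c : cmd, forall n, exists B s,
    exec [::] B c [:: n] s /\ reg s 0 = f n.

Record param_problem := ParamProblem {
  instance : Type;
  encode : instance -> seq bool;
  yes : instance -> Prop;
  param : instance -> nat
}.

(* The additive constant of O(log n) is absorbed by f.  The value of the
   parameter is not part of the input. *)
Definition para_L (P : param_problem) : Prop :=
  exists (c : cmd) (f : nat -> nat) (d : nat),
    computable f /\
    forall x : instance P,
      answers c (encode x) (f (param x) + d * trunc_log 2 (size (encode x)))
        (yes x).

(** * Encodings and the deletion problem *)

(* 1^n 0 followed by the adjacency matrix in row-major order, n = #|G|. *)
Definition encode_graph (G : sgraph) : seq bool :=
  nseq #|G| true ++ false :: [seq adj x y | x <- enum G, y <- enum G].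

(* Binary representation, least significant bit first. *)
Definition encode_nat (k : nat) : seq bool :=
  mkseq (fun i => odd (k %/ 2 ^ i)) (bitsize k).

(* Needed for any algorithm: for an undecidable set A of integers >= 3, the
   Hamiltonian graphs with order in A satisfy the combinatorial hypotheses (with
   c = 2 and p = 2X), but deciding whether (C_n, 0) is a yes-instance of
   [free_deletion] amounts to deciding whether n is in A. *)
Definition decidable_class (Pi : sgraph -> Prop) : Prop :=
  exists c : cmd, forall G, exists B, answers c (encode_graph G) B (Pi G).

Definition free_deletion (Pi : sgraph -> Prop) (G : sgraph) (k : nat) : Prop :=
  exists S : {set G}, #|S| <= k /\ free_of Pi (remove S).

Definition free_deletion_by_vc (Pi : sgraph -> Prop) : param_problem :=
  {| instance := sgraph * nat;
     encode x := encode_graph x.1 ++ encode_nat x.2;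
     yes x := free_deletion Pi x.1 x.2;
     param x := vc_number x.1 |}.

(* Main.v *)
(* Call high the vertices of degree more than [d].  The high vertices and the
   neighbours of the others form a vertex cover, of at most [d + d ^ 2] vertices if
   [d] is the vertex cover number.  For the least [d] with this bound, membership
   in the cover [X] is decided in logarithmic space, without storing [X].  Label
   each vertex by its neighbours in [X] and its position in [X]: the labels of two
   vertices tell whether they are adjacent, and there are boundedly many labels in
   terms of [d].  As a minimal graph of the class has boundedly many vertices, say
   at most [N], whether [G - S] is free only depends on how many vertices of each
   label are kept, truncated at [N]; call this an option.

   An option is tested by running the decision procedure of the class on all graphs
   given by words of at most [N] labels that it allows, which does not involve the
   input, and the number of vertices that it deletes is counted in logarithmic
   space.  The space used by the tests is bounded by a computable function of the
   parameter: the tests can be instrumented so that they add up all the values that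
   they assign, and these totals are summed over all options. *)
From Stdlib Require Import Classical IndefiniteDescription.
Require Import Defs.
From mathcomp Require Import all_boot all_order all_algebra.
From mathcomp Require Import zify.
Set Implicit Arguments.
Unset Strict Implicit.
Unset Printing Implicit Defensive.

(** * Bounding the values instead of the space *)

Arguments reg : simpl never.

(** A decision procedure for the class comes with termination but without any space bound, whereas
    [para_L] asks for a computable one: this is what forces the instrumentation, whose totals are
    outputs of a program and hence computable. Moreover the procedure expects a graph on its input,
    while the graphs to be tested are never written down; so it is simulated, and each reading of
    the input is replaced by a computation of the requested bit. Space is controlled through values.
    A program has a fixed number of registers, so values up to [f(k) + O(n)] cost [g(k) + O(log n)]
    bits. Thus everything that depends on the parameter only (words, options, neighbourhoods in the
    cover) is packed into the digits of one number, and everything that depends on the graph is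
    recomputed whenever it is needed. The program does not know the vertex cover number [k]; it
    finds a bound of its own, which is only known to be at most [k + k ^ 2], so [f] adds the costs
    for all values up to there. The polynomial may have arbitrary real coefficients; it is replaced
    by a function [a * b ^ m] with natural [a] and [b]. *)

Lemma reg_set s x v i : reg (set_nth 0 s x v) i = if i == x then v else reg s i.
Proof. by rewrite /reg nth_set_nth. Qed.

(* [exec] with a bound on the values instead of the space: for a program with [R]
   registers, values up to [M] take [R * bitsize M] bits. *)
Inductive run (w : seq bool) (M : nat) : cmd -> store -> store -> Prop :=
| RunSkip s : run w M Skip s s
| RunAssign x r s :
    rhs_sem w s r <= M -> run w M (Assign x r) s (set_nth 0 s x (rhs_sem w s r))
| RunSeq c1 c2 s1 s2 s3 :
    run w M c1 s1 s2 -> run w M c2 s2 s3 -> run w M (Seq c1 c2) s1 s3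
| RunIfTrue x c1 c2 s s' :
    reg s x != 0 -> run w M c1 s s' -> run w M (If x c1 c2) s s'
| RunIfFalse x c1 c2 s s' :
    reg s x = 0 -> run w M c2 s s' -> run w M (If x c1 c2) s s'
| RunWhileTrue x c s1 s2 s3 :
    reg s1 x != 0 -> run w M c s1 s2 -> run w M (While x c) s2 s3 ->
    run w M (While x c) s1 s3
| RunWhileFalse x c s : reg s x = 0 -> run w M (While x c) s s.

Lemma run_mono w M M' c s s' : M <= M' -> run w M c s s' -> run w M' c s s'.
Proof.
move=> leM; elim=> {c s s'} [s|x r s le_r|c1 c2 s1 s2 s3 _ r1 _ r2
  |x c1 c2 s s' nz _ r|x c1 c2 s s' z _ r|x c s1 s2 s3 nz _ r1 _ r2|x c s z].
- exact: RunSkip.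
- by apply: RunAssign; apply: leq_trans leM.
- exact: RunSeq r1 r2.
- exact: RunIfTrue.
- exact: RunIfFalse.
- exact: RunWhileTrue nz r1 r2.
- exact: RunWhileFalse.
Qed.

(** Only termination is used: [M] is the largest value assigned in this derivation and has no
    relation to [B]. *)
Lemma exec_run w B c s s' : exec w B c s s' -> exists M, run w M c s s'.
Proof.
elim=> {c s s'} [s|x r s _|c1 c2 s1 s2 s3 _ [M1 r1] _ [M2 r2]
  |x c1 c2 s s' nz _ [M r]|x c1 c2 s s' z _ [M r]
  |x c s1 s2 s3 nz _ [M1 r1] _ [M2 r2]|x c s z].
- by exists 0; apply: RunSkip.
- by exists (rhs_sem w s r); apply: RunAssign.
- exists (maxn M1 M2); apply: (RunSeq (s2 := s2)).
    exact: run_mono (leq_maxl _ _) r1.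
  exact: run_mono (leq_maxr _ _) r2.
- by exists M; apply: RunIfTrue.
- by exists M; apply: RunIfFalse.
- exists (maxn M1 M2); apply: (RunWhileTrue (s2 := s2)) => //.
    exact: run_mono (leq_maxl _ _) r1.
  exact: run_mono (leq_maxr _ _) r2.
- by exists 0; apply: RunWhileFalse.
Qed.

Lemma run_le w M c s s' : run w M c s s' ->
  (forall i, reg s i <= M) -> forall i, reg s' i <= M.
Proof.
elim=> {c s s'} //; last by auto.
- by move=> x r s le_r le_s i; rewrite reg_set; case: eqP.
- by auto.
Qed.

Definition rhs_regs r := match r with
  | Const _ => 0 | Binop _ y z => maxn y.+1 z.+1 | Input y => y.+1 end.

Fixpoint regs c := match c with
  | Skip => 0
  | Assign x r => maxn x.+1 (rhs_regs r)
  | Seq c1 c2 => maxn (regs c1) (regs c2)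
  | If x c1 c2 => maxn x.+1 (maxn (regs c1) (regs c2))
  | While x c => maxn x.+1 (regs c)
  end.

Lemma bitsize_mono m n : m <= n -> bitsize m <= bitsize n.
Proof. by move=> le_mn; apply: leq_up_log. Qed.

Lemma space_le R M s : size s <= R -> (forall i, reg s i <= M) ->
  Defs.space s <= R * bitsize M.
Proof.
move=> le_sR le_sM; rewrite /Defs.space (big_nth 0) big_mkord.
apply: (@leq_trans (\sum_(i < size s) bitsize M)).
  by apply: leq_sum => i _; apply/bitsize_mono/le_sM.
by rewrite sum_nat_const card_ord leq_mul2r le_sR orbT.
Qed.

(** Assigning a register may lengthen the store, so its size is carried along as an invariant; it
    stays below [R] because all registers of [c] do. *)
Lemma run_exec R B w M c s s' : run w M c s s' -> R * bitsize M <= B ->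
  regs c <= R -> size s <= R -> (forall i, reg s i <= M) ->
  exec w B c s s' /\ size s' <= R.
Proof.
move=> r leB; elim: r => {c s s'} [s|x r s le_r|c1 c2 s1 s2 s3 run1 r1 _ r2
  |x c1 c2 s s' nz _ r|x c1 c2 s s' z _ r|x c s1 s2 s3 nz run1 r1 _ r2|x c s z] /=;
  rewrite ?geq_max.
- by split=> //; apply: ExecSkip.
- case/andP=> lt_x _ le_sR le_sM.
  have le_s'R : size (set_nth 0 s x (rhs_sem w s r)) <= R.
    by rewrite size_set_nth geq_max lt_x.
  split=> //; apply: ExecAssign; apply: leq_trans (space_le le_s'R _) leB => i.
  by rewrite reg_set; case: eqP.
- case/andP=> le1 le2 le_s le_sM; have [e1 le_s2] := r1 le1 le_s le_sM.
  have [e2 le_s3] := r2 le2 le_s2 (run_le run1 le_sM).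
  by split=> //; apply: ExecSeq e1 e2.
- case/and3P=> _ le1 _ le_s le_sM; have [e le_s'] := r le1 le_s le_sM.
  by split=> //; apply: ExecIfTrue.
- case/and3P=> _ _ le1 le_s le_sM; have [e le_s'] := r le1 le_s le_sM.
  by split=> //; apply: ExecIfFalse.
- case/andP=> lex le1 le_s le_sM; have [e1 le_s2] := r1 le1 le_s le_sM.
  have [|e2 le_s3] := r2 _ le_s2 (run_le run1 le_sM).
    by rewrite geq_max lex.
  by split=> //; apply: ExecWhileTrue nz e1 e2.
- by split=> //; apply: ExecWhileFalse.
Qed.

(* The total kept in register [t] bounds each of the assigned values. *)
Fixpoint instr t c := match c with
  | Skip => Skip
  | Assign x r => Seq (Assign x r) (Assign t (Binop OpAdd t x))
  | Seq c1 c2 => Seq (instr t c1) (instr t c2)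
  | If x c1 c2 => If x (instr t c1) (instr t c2)
  | While x c => While x (instr t c)
  end.

Lemma eq_rhs_sem R w s S r : rhs_regs r <= R ->
  (forall i, i < R -> reg S i = reg s i) -> rhs_sem w S r = rhs_sem w s r.
Proof.
case: r => //= [o y z|y]; rewrite ?geq_max.
  by case/andP=> le_y le_z eqS; rewrite !eqS.
by move=> le_y eqS; rewrite eqS.
Qed.

(** The given [M] is discarded: [K] is the sum of the values assigned during the run. Since the
    total only grows, its final value also bounds the instrumented run, so that the cost of
    computing the bound is known as well. *)
Lemma run_instr w M c s s' : run w M c s s' -> forall t S, regs c <= t ->
  (forall i, i < t -> reg S i = reg s i) ->
  exists K S', [/\ run w K c s s', run w (reg S t + K) (instr t c) S S',
    reg S' t = reg S t + K & forall i, i < t -> reg S' i = reg s' i].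
Proof.
elim=> {c s s'} [s|x r s le_r|c1 c2 s1 s2 s3 run1 r1 _ r2
  |x c1 c2 s s' nz _ rr|x c1 c2 s s' z _ rr|x c s1 s2 s3 nz run1 r1 _ r2|x c s z] /=
  t S; rewrite ?geq_max.
- by move=> _ eqS; exists 0, S; rewrite addn0; split=> //; apply: RunSkip.
- case/andP=> lt_x le_rt eqS; set v := rhs_sem w s r.
  have eqv : rhs_sem w S r = v by apply: eq_rhs_sem eqS.
  pose S1 := set_nth 0 S x v.
  have S1t : reg S1 t = reg S t by rewrite reg_set gtn_eqF.
  have S1x : reg S1 x = v by rewrite reg_set eqxx.
  exists v, (set_nth 0 S1 t (rhs_sem w S1 (Binop OpAdd t x))); split.
  + exact: RunAssign.
  + apply: (RunSeq (s2 := S1)).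
      by rewrite /S1 -eqv; apply: RunAssign; rewrite eqv leq_addl.
    by apply: RunAssign; rewrite /= S1t S1x.
  + by rewrite reg_set eqxx /= S1t S1x.
  + by move=> i lt_i; rewrite !reg_set ltn_eqF //; case: eqP => // _; apply: eqS.
- case/andP=> le1 le2 eqS; have [K1 [S1 [a1 b1 e1 eq1]]] := r1 _ _ le1 eqS.
  have [K2 [S2 [a2 b2 e2 eq2]]] := r2 _ _ le2 eq1.
  exists (K1 + K2), S2; split=> //.
  + apply: (RunSeq (s2 := s2)); first exact: run_mono (leq_addr _ _) a1.
    exact: run_mono (leq_addl _ _) a2.
  + apply: (RunSeq (s2 := S1)); last by rewrite addnA -e1.
    by apply: run_mono b1; rewrite leq_add2l leq_addr.
  + by rewrite e2 e1 addnA.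
- case/and3P=> lt_x le1 _ eqS; have [K [S' [a b e eq1]]] := rr _ _ le1 eqS.
  exists K, S'; split=> //; apply: RunIfTrue => //; by rewrite eqS.
- case/and3P=> lt_x _ le1 eqS; have [K [S' [a b e eq1]]] := rr _ _ le1 eqS.
  exists K, S'; split=> //; apply: RunIfFalse => //; by rewrite eqS.
- case/andP=> lt_x le1 eqS; have [K1 [S1 [a1 b1 e1 eq1]]] := r1 _ _ le1 eqS.
  have [|K2 [S2 [a2 b2 e2 eq2]]] := r2 t S1 _ eq1; first by rewrite geq_max lt_x.
  exists (K1 + K2), S2; split=> //.
  + apply: (RunWhileTrue (s2 := s2)) => //.
      exact: run_mono (leq_addr _ _) a1.
    exact: run_mono (leq_addl _ _) a2.
  + apply: (RunWhileTrue (s2 := S1)); first by rewrite eqS.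
      by apply: run_mono b1; rewrite leq_add2l leq_addr.
    by rewrite addnA -e1.
  + by rewrite e2 e1 addnA.
- case/andP=> lt_x _ eqS; exists 0, S; rewrite addn0; split=> //.
    exact: RunWhileFalse.
  by apply: RunWhileFalse; rewrite eqS.
Qed.

(** * Compositional programs *)

(* In the context [x], with the values [env x] stored in the registers [l] and on
   any input [w] allowed by [P x], the program [c l k] writes [F x] to register
   [k], leaves the registers below [k] alone and assigns no value above [M x]. *)
Definition computes (X : Type) (P : X -> seq bool -> Prop) (env : X -> seq nat)
    (M F : X -> nat) : Prop :=
  exists c : seq nat -> nat -> cmd, forall x w l k s,
    P x w -> all (fun r => r < k) l -> map (reg s) l = env x ->
    F x <= M x /\
    exists s', [/\ run w (M x) (c l k) s s', reg s' k = F x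
                 & forall i, i < k -> reg s' i = reg s i].

Lemma eq_map_reg k s s' l : all (fun r => r < k) l ->
  (forall i, i < k -> reg s' i = reg s i) -> map (reg s') l = map (reg s) l.
Proof. by move=> /allP lt_l eqs; apply/eq_in_map => r /lt_l; apply: eqs. Qed.

Lemma all_ltW k k' l : k <= k' ->
  all (fun r => r < k) l -> all (fun r => r < k') l.
Proof. by move=> lek; apply: sub_all => r ltr; apply: leq_trans lek. Qed.

Section Closure.
Variables (X : Type) (P : X -> seq bool -> Prop) (env : X -> seq nat).
Variable M : X -> nat.
Implicit Types A B F H : X -> nat.

Lemma computes_ext F F' :
  (forall x w, P x w -> F x = F' x) -> computes P env M F -> computes P env M F'.
Proof.
move=> eqF [c cP]; exists c => x w l k s Px ltl eql.
by rewrite -(eqF _ _ Px); apply: cP.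
Qed.

(** A program for an outer context serves under binders: it is called on the register list without
    the [m] values pushed since. *)
Lemma computes_weak (Y : Type) (Q : Y -> seq bool -> Prop) env' M' (g : Y -> X) m F :
  (forall y w, Q y w ->
     [/\ P (g y) w, drop m (env' y) = env (g y) & M (g y) <= M' y]) ->
  computes P env M F -> computes Q env' M' (fun y => F (g y)).
Proof.
move=> QP [c cP]; exists (fun l k => c (drop m l) k) => y w l k s Qy ltl eql.
have [Px eqe leM] := QP _ _ Qy.
have [||leF [s' [r e1 e2]]] := cP _ _ (drop m l) k s Px.
- by apply/allP=> i /mem_drop; move/allP: ltl; apply.
- by rewrite map_drop eql.
split; first exact: leq_trans leM.
by exists s'; split=> //; apply: run_mono r.
Qed.

Lemma computes_var i F :
  (forall x w, P x w ->
     [/\ i < size (env x), nth 0 (env x) i = F x & F x <= M x]) ->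
  computes P env M F.
Proof.
(* The machine has no copy instruction: a register is copied by subtracting a fresh 0 from it. *)
move=> iP; exists (fun l k => Seq (Assign k.+1 (Const 0))
  (Assign k (Binop OpSub (nth 0 l i) k.+1))) => x w l k s Px ltl eql.
have [lti eqF leF] := iP _ _ Px; split=> //.
have {}lti : i < size l by move: lti; rewrite -eql size_map.
have ltk : nth 0 l i < k by move/allP: ltl; apply; rewrite mem_nth.
have eqi : reg s (nth 0 l i) = F x by rewrite -eqF -eql (nth_map 0).
set s1 := set_nth 0 s k.+1 0.
have eqv : rhs_sem w s1 (Binop OpSub (nth 0 l i) k.+1) = F x.
  by rewrite /= !reg_set eqxx subn0 ltn_eqF 1?eqi // ltnW.
exists (set_nth 0 s1 k (F x)); split.
- apply: (RunSeq (s2 := s1)); first exact: (@RunAssign _ _ _ (Const 0)).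
  by rewrite -eqv; apply: RunAssign; rewrite eqv.
- by rewrite reg_set eqxx.
- by move=> j ltj; rewrite !reg_set !ltn_eqF // ltnW.
Qed.

Lemma computes_const n :
  (forall x w, P x w -> n <= M x) -> computes P env M (fun=> n).
Proof.
move=> leM; exists (fun l k => Assign k (Const n)) => x w l k s Px ltl eql.
have le := leM _ _ Px; split=> //; exists (set_nth 0 s k n); split.
- exact: (@RunAssign _ _ _ (Const n)).
- by rewrite reg_set eqxx.
- by move=> j ltj; rewrite reg_set ltn_eqF.
Qed.

Lemma computes_bin o A B :
  computes P env M A -> computes P env M B ->
  (forall x w, P x w -> A x <= M x -> B x <= M x ->
     binop_sem o (A x) (B x) <= M x) ->
  computes P env M (fun x => binop_sem o (A x) (B x)).
Proof.
move=> [ca caP] [cb cbP] leM.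
(* The register [k] acts as a stack pointer: the first operand survives in [k] because the second
   program starts at [k.+1]. *)
exists (fun l k => Seq (ca l k) (Seq (cb l k.+1) (Assign k (Binop o k k.+1)))).
move=> x w l k s Px ltl eql.
have [leA [s1 [r1 v1 e1]]] := caP _ _ _ _ _ Px ltl eql.
have [||leB [s2 [r2 v2 e2]]] := cbP _ w l k.+1 s1 Px.
- exact: all_ltW ltl.
- by rewrite (eq_map_reg ltl e1).
have le := leM _ _ Px leA leB; split=> //.
set v := binop_sem o (A x) (B x) in le *.
have eqv : rhs_sem w s2 (Binop o k k.+1) = v by rewrite /= v2 e2 // v1.
exists (set_nth 0 s2 k v); split.
- apply: RunSeq r1 _; apply: RunSeq r2 _.
  by rewrite -eqv; apply: RunAssign; rewrite eqv.
- by rewrite reg_set eqxx.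
- by move=> j ltj; rewrite reg_set ltn_eqF // e2 ?e1 // ltnW.
Qed.

Lemma computes_add A B : computes P env M A -> computes P env M B ->
  (forall x w, P x w -> A x + B x <= M x) -> computes P env M (fun x => A x + B x).
Proof. by move=> cA cB le; apply: (@computes_bin OpAdd) => // x w /le. Qed.

Lemma computes_mul A B : computes P env M A -> computes P env M B ->
  (forall x w, P x w -> A x * B x <= M x) -> computes P env M (fun x => A x * B x).
Proof. by move=> cA cB le; apply: (@computes_bin OpMul) => // x w /le. Qed.

Lemma computes_sub A B : computes P env M A -> computes P env M B ->
  computes P env M (fun x => A x - B x).
Proof.
move=> cA cB; apply: (@computes_bin OpSub) => // x w _ leA _ /=.
exact: leq_trans (leq_subr _ _) leA.
Qed.

Lemma computes_div A B : computes P env M A -> computes P env M B ->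
  computes P env M (fun x => A x %/ B x).
Proof.
move=> cA cB; apply: (@computes_bin OpDiv) => // x w _ leA _ /=.
exact: leq_trans (leq_div _ _) leA.
Qed.

Lemma computes_mod A B : computes P env M A -> computes P env M B ->
  computes P env M (fun x => A x %% B x).
Proof.
move=> cA cB; apply: (@computes_bin OpMod) => // x w _ leA _ /=.
exact: leq_trans (leq_mod _ _) leA.
Qed.

Lemma computes_input A F : computes P env M A ->
  (forall x w, P x w -> nth 2 (map nat_of_bool w) (A x) = F x /\ F x <= M x) ->
  computes P env M F.
Proof.
move=> [ca caP] FP; exists (fun l k => Seq (ca l k) (Assign k (Input k))).
move=> x w l k s Px ltl eql; have [eqF leF] := FP _ _ Px; split=> //.
have [leA [s1 [r1 v1 e1]]] := caP _ _ _ _ _ Px ltl eql.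
have eqv : rhs_sem w s1 (Input k) = F x by rewrite /= v1.
exists (set_nth 0 s1 k (F x)); split.
- by apply: RunSeq r1 _; rewrite -eqv; apply: RunAssign; rewrite eqv.
- by rewrite reg_set eqxx.
- by move=> j ltj; rewrite reg_set ltn_eqF // e1.
Qed.

(** The premise on the body takes the accumulator to be the true partial result, so bounds on values
    are needed only for the states that really occur. *)
Lemma computes_fold H A (G : X -> nat -> nat -> nat) :
  computes P env M H -> computes P env M A ->
  computes (fun (p : X * nat * nat) w =>
          [/\ P p.1.1 w, p.1.2 < H p.1.1 <= M p.1.1, p.2 <= M p.1.1
            & p.2 = iteri p.1.2 (G p.1.1) (A p.1.1)])
       (fun p => p.2 :: p.1.2 :: env p.1.1) (fun p => M p.1.1)
       (fun p => G p.1.1 p.1.2 p.2) ->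
  computes P env M (fun x => iteri (H x) (G x) (A x)).
Proof.
move=> [ch chP] [ca caP] [cb cbP].
(* Layout: [k] is the accumulator, [k.+1] the index, [k.+2] the number of rounds left, [k.+3] the
   new accumulator and [k.+4] holds the constants 0 and 1. *)
pose body l k := Seq (cb [:: k, k.+1 & l] k.+3)
  (Seq (Assign k.+4 (Const 0)) (Seq (Assign k (Binop OpSub k.+3 k.+4))
  (Seq (Assign k.+4 (Const 1)) (Seq (Assign k.+1 (Binop OpAdd k.+1 k.+4))
       (Assign k.+2 (Binop OpSub k.+2 k.+4)))))).
exists (fun l k => Seq (ca l k) (Seq (ch l k.+2)
  (Seq (Assign k.+1 (Const 0)) (While k.+2 (body l k))))).
move=> x w l k s Px ltl eql.
have [leA [s1 [r1 v1 e1]]] := caP _ _ _ _ _ Px ltl eql.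
have [||leH [s2 [r2 v2 e2]]] := chP _ w l k.+2 s1 Px.
- by apply: all_ltW ltl; lia.
- by rewrite (eq_map_reg ltl e1).
set I := fun j => iteri j (G x) (A x).
have loop d j S : j + d = H x -> reg S k = I j -> reg S k.+1 = j ->
    reg S k.+2 = d -> (forall i, i < k -> reg S i = reg s i) -> I j <= M x ->
    I (H x) <= M x /\
    exists S', [/\ run w (M x) (While k.+2 (body l k)) S S', reg S' k = I (H x)
                 & forall i, i < k -> reg S' i = reg s i].
  elim: d j S => [|d IHd] j S jd Sk Sk1 Sk2 Si leI.
    have eqj : j = H x by lia.
    rewrite -eqj; split=> //; exists S; split=> //.
    exact: RunWhileFalse.
  have [||| leG [s3 [r3 v3 e3]]] :=
      cbP (x, j, I j) w [:: k, k.+1 & l] k.+3 S.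
  - by split=> //=; lia.
  - by rewrite /=; apply/and3P; split; [lia|lia|apply: all_ltW ltl; lia].
  - by rewrite /= Sk Sk1 (eq_map_reg ltl Si) eql.
  rewrite /= in r3 v3 leG.
  have M1 : 0 < M x by lia.
  pose s4 := set_nth 0 s3 k.+4 0.
  pose s5 := set_nth 0 s4 k (I j.+1).
  pose s6 := set_nth 0 s5 k.+4 1.
  pose s7 := set_nth 0 s6 k.+1 j.+1.
  pose s8 := set_nth 0 s7 k.+2 d.
  have lt01 (a b : nat) : a < b -> (a == b) = false by lia.
  have lt10 (a b : nat) : b < a -> (a == b) = false by lia.
  have rb : run w (M x) (body l k) S s8.
    apply: RunSeq r3 _.
    apply: (RunSeq (s2 := s4)); first exact: (@RunAssign _ _ _ (Const 0)).
    have q5 : rhs_sem w s4 (Binop OpSub k.+3 k.+4) = I j.+1.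
      rewrite /= !reg_set eqxx lt01; last by lia.
      by rewrite v3 subn0.
    apply: (RunSeq (s2 := s5)).
      by rewrite /s5 -q5; apply: RunAssign; rewrite q5.
    apply: (RunSeq (s2 := s6)); first exact: (@RunAssign _ _ _ (Const 1)).
    have q7 : rhs_sem w s6 (Binop OpAdd k.+1 k.+4) = j.+1.
      rewrite /= !reg_set eqxx !(lt01 k.+1 k.+4) ?(lt10 k.+1 k); try lia.
      by rewrite e3 ?Sk1 ?addn1; lia.
    apply: (RunSeq (s2 := s7)).
      by rewrite /s7 -q7; apply: RunAssign; rewrite q7; lia.
    have q8 : rhs_sem w s7 (Binop OpSub k.+2 k.+4) = d.
      rewrite /= !reg_set eqxx.
      rewrite (lt10 k.+4 k.+1) ?(lt01 k.+2 k.+4) ?(lt10 k.+2 k.+1) ?(lt10 k.+2 k); try lia.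
      by rewrite e3 ?Sk2; lia.
    by rewrite /s8 -q8; apply: RunAssign; rewrite q8; lia.
  have [||||| |leF [S' [rS vS eS]]] := IHd j.+1 s8.
  - by lia.
  - rewrite /s8 /s7 /s6 !reg_set (lt01 k k.+2) ?(lt01 k k.+1) ?(lt01 k k.+4); try lia.
    by rewrite eqxx.
  - by rewrite /s8 /s7 !reg_set (lt01 k.+1 k.+2) ?eqxx //; lia.
  - by rewrite reg_set eqxx.
  - move=> i lti; rewrite !reg_set !lt01; try lia.
    by rewrite e3 ?Si //; lia.
  - by [].
  split=> //; exists S'; split=> //.
  by apply: RunWhileTrue rb rS; rewrite Sk2.
pose s3 := set_nth 0 s2 k.+1 0.
have [|||||leF [S' [rS vS eS]]] := loop (H x) 0 s3 (add0n _).
- by rewrite reg_set ltn_eqF // e2 ?v1.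
- by rewrite reg_set eqxx.
- by rewrite reg_set gtn_eqF.
- by move=> i lti; rewrite reg_set ltn_eqF ?e2 ?e1 //; lia.
- by [].
split=> //; exists S'; split=> //.
apply: RunSeq r1 _; apply: RunSeq r2 _; apply: (RunSeq (s2 := s3)) rS.
exact: (@RunAssign _ _ _ (Const 0)).
Qed.

(** Search with no upper limit known to the program: the candidates never go beyond the least
    solution [F], so the test may assume [q.2 <= F q.1] when its values are bounded. *)
Lemma computes_mu (p : X -> nat -> nat) F :
  (forall x w, P x w -> [/\ 0 < M x, F x <= M x, p x (F x) != 0
     & forall i, i < F x -> p x i = 0]) ->
  computes (fun (q : X * nat) w => P q.1 w /\ q.2 <= F q.1)
       (fun q => q.2 :: env q.1) (fun q => M q.1) (fun q => p q.1 q.2) ->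
  computes P env M F.
Proof.
move=> FP [cb cbP].
pose test l k := Seq (cb (k :: l) k.+1) (Seq (Assign k.+2 (Const 1))
  (Assign k.+1 (Binop OpSub k.+2 k.+1))).
pose body l k := Seq (Assign k.+2 (Const 1))
    (Seq (Assign k (Binop OpAdd k k.+2)) (test l k)).
exists (fun l k => Seq (Assign k (Const 0)) (Seq (test l k)
  (While k.+1 (body l k)))).
move=> x w l k s Px ltl eql; have [M1 leF nz z] := FP _ _ Px; split=> //.
have testP j S : j <= F x -> reg S k = j -> (forall i, i < k -> reg S i = reg s i) ->
    exists S', [/\ run w (M x) (test l k) S S', reg S' k = j,
      reg S' k.+1 = 1 - p x j & forall i, i < k -> reg S' i = reg s i].
  move=> lej Sk Si.
  have [||| leG [s1 [r1 v1 e1]]] := cbP (x, j) w (k :: l) k.+1 S.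
  - by [].
  - by rewrite /= ltnSn; apply: all_ltW ltl; lia.
  - by rewrite /= Sk (eq_map_reg ltl Si) eql.
  rewrite /= in r1 v1 leG.
  pose s2 := set_nth 0 s1 k.+2 1.
  have q : rhs_sem w s2 (Binop OpSub k.+2 k.+1) = 1 - p x j.
    by rewrite /= !reg_set eqxx ltn_eqF // v1.
  exists (set_nth 0 s2 k.+1 (1 - p x j)); split.
  - apply: RunSeq r1 _.
    apply: (RunSeq (s2 := s2)); first exact: (@RunAssign _ _ _ (Const 1)).
    by rewrite -q; apply: RunAssign; rewrite q; lia.
  - by rewrite !reg_set !ltn_eqF ?e1 //; lia.
  - by rewrite reg_set eqxx.
  - by move=> i lti; rewrite !reg_set !ltn_eqF ?e1 ?Si //; lia.
have loop d j S : j + d = F x -> reg S k = j -> reg S k.+1 = 1 - p x j ->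
    (forall i, i < k -> reg S i = reg s i) ->
    exists S', [/\ run w (M x) (While k.+1 (body l k)) S S',
      reg S' k = F x & forall i, i < k -> reg S' i = reg s i].
  elim: d j S => [|d IHd] j S jd Sk Sk1 Si.
    have eqj : j = F x by lia.
    exists S; split=> //; last by rewrite Sk.
    by apply: RunWhileFalse; rewrite Sk1 eqj; lia.
  pose s1 := set_nth 0 S k.+2 1.
  pose s2 := set_nth 0 s1 k j.+1.
  have [|||s3 [r3 k3 p3 e3]] := testP j.+1 s2.
  - by lia.
  - by rewrite reg_set eqxx.
  - by move=> i lti; rewrite !reg_set !ltn_eqF ?Si //; lia.
  have q : rhs_sem w s1 (Binop OpAdd k k.+2) = j.+1.
    by rewrite /= !reg_set eqxx ltn_eqF // Sk addn1.
  have [||||S' [rS kS eS]] := IHd j.+1 s3 => //; first by lia.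
  exists S'; split=> //; apply: RunWhileTrue rS.
    by rewrite Sk1 z //; lia.
  apply: (RunSeq (s2 := s1)); first exact: (@RunAssign _ _ _ (Const 1)).
  by apply: RunSeq r3; rewrite /s2 -q; apply: RunAssign; rewrite q; lia.
pose s0 := set_nth 0 s k 0.
have [|||s1 [r1 k1 p1 e1]] := testP 0 s0 => //.
- by rewrite reg_set eqxx.
- by move=> i lti; rewrite !reg_set !ltn_eqF.
have [||||S' [rS kS eS]] := loop (F x) 0 s1 => //.
exists S'; split=> //; apply: (RunSeq (s2 := s0)).
  exact: (@RunAssign _ _ _ (Const 0)).
exact: RunSeq r1 rS.
Qed.

End Closure.

(** * Simulating a program on a virtual input *)

(* [c] with its registers shifted by [b] and each reading of the input at the
   address held in register [r] replaced by [inp r], which leaves the bit read in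
   register [t]. *)
Fixpoint sim (inp : nat -> cmd) (b t : nat) (c : cmd) : cmd :=
  match c with
  | Skip => Skip
  | Assign x (Const n) => Assign (b + x) (Const n)
  | Assign x (Binop o y z) => Assign (b + x) (Binop o (b + y) (b + z))
  | Assign x (Input y) => Seq (inp (b + y))
      (Seq (Assign t.+1 (Const 0)) (Assign (b + x) (Binop OpSub t t.+1)))
  | Seq c1 c2 => Seq (sim inp b t c1) (sim inp b t c2)
  | If x c1 c2 => If (b + x) (sim inp b t c1) (sim inp b t c2)
  | While x c => While (b + x) (sim inp b t c)
  end.

Section Sim.
Variables (w v : seq bool) (M M0 b R : nat) (inp : nat -> cmd) (S0 : store).
Hypothesis leM : M0 <= M.
Hypothesis inpP : forall r S, b <= r < b + R -> reg S r <= M0 ->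
  (forall i, i < b -> reg S i = reg S0 i) ->
  exists S', [/\ run w M (inp r) S S',
    reg S' (b + R) = nth 2 (map nat_of_bool v) (reg S r)
    & forall i, i < b + R -> reg S' i = reg S i].

(** The registers below [b] belong to the caller. They must keep their initial contents, since [inp]
    computes the bits of the virtual input from them. *)
Definition simulates (s S : store) : Prop :=
  (forall i, i < R -> reg S (b + i) = reg s i) /\
  (forall i, i < b -> reg S i = reg S0 i).

Lemma simulates_set s S x a : x < R -> simulates s S ->
  simulates (set_nth 0 s x a) (set_nth 0 S (b + x) a).
Proof.
move=> ltx [eq1 eq2]; split=> i lti; rewrite !reg_set.
  by rewrite eqn_add2l eq1.
by rewrite ltn_eqF ?eq2 //; lia.
Qed.

Lemma run_sim c s s' : run v M0 c s s' -> regs c <= R ->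
  (forall i, reg s i <= M0) -> forall S, simulates s S ->
  exists S', run w M (sim inp b (b + R) c) S S' /\ simulates s' S'.
Proof.
elim=> {c s s'} [s|x r s le_r|c1 c2 s1 s2 s3 run1 r1 _ r2
  |x c1 c2 s s' nz _ rr|x c1 c2 s s' z _ rr|x c s1 s2 s3 nz run1 r1 _ r2|x c s z] /=;
  rewrite ?geq_max.
- by move=> _ _ S SS; exists S; split=> //; apply: RunSkip.
- case/andP=> ltx; case: r le_r => /= [n|o y z|y] len; rewrite ?geq_max.
  + move=> _ les S SS; exists (set_nth 0 S (b + x) n).
    split; last exact: simulates_set.
    by apply: (@RunAssign _ _ _ (Const n)); apply: leq_trans leM.
  + case/andP=> lty ltz les S SS; set a := binop_sem _ _ _ in len *.
    have q : rhs_sem w S (Binop o (b + y) (b + z)) = a.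
      by rewrite /= !SS.1.
    exists (set_nth 0 S (b + x) a); split; last exact: simulates_set.
    by rewrite -q; apply: RunAssign; rewrite q; apply: leq_trans leM.
  + move=> lty les S SS; set a := nth 2 _ _ in len *.
    have [|||S1 [r1 v1 e1]] := @inpP (b + y) S; first by lia.
    * by rewrite SS.1.
    * exact: SS.2.
    rewrite SS.1 // -/a in v1.
    pose S2 := set_nth 0 S1 (b + R).+1 0.
    have q : rhs_sem w S2 (Binop OpSub (b + R) (b + R).+1) = a.
      by rewrite /= !reg_set eqxx ltn_eqF // v1 subn0.
    exists (set_nth 0 S2 (b + x) a); split.
      apply: RunSeq r1 _; apply: (RunSeq (s2 := S2)).
        exact: (@RunAssign _ _ _ (Const 0)).
      by rewrite -q; apply: RunAssign; rewrite q; apply: leq_trans leM.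
    apply: simulates_set => //; split=> i lti; rewrite reg_set ltn_eqF ?e1; try lia.
      by rewrite SS.1.
    by rewrite SS.2.
- case/andP=> le1 le2 les S SS; have [S1 [a1 SS1]] := r1 le1 les S SS.
  have [S2 [a2 SS2]] := r2 le2 (run_le run1 les) S1 SS1.
  by exists S2; split=> //; apply: RunSeq a1 a2.
- case/and3P=> ltx le1 le2 les S SS; have [S1 [a1 SS1]] := rr le1 les S SS.
  by exists S1; split=> //; apply: RunIfTrue => //; rewrite SS.1.
- case/and3P=> ltx le1 le2 les S SS; have [S1 [a1 SS1]] := rr le2 les S SS.
  by exists S1; split=> //; apply: RunIfFalse => //; rewrite SS.1.
- case/andP=> ltx le1 les S SS; have [S1 [a1 SS1]] := r1 le1 les S SS.
  have [|S2 [a2 SS2]] := r2 _ (run_le run1 les) S1 SS1; first by rewrite geq_max ltx.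
  by exists S2; split=> //; apply: RunWhileTrue a1 a2; rewrite SS.1.
- case/andP=> ltx _ les S SS; exists S; split=> //.
  by apply: RunWhileFalse; rewrite SS.1.
Qed.

End Sim.

(** A called program expects 0 in all registers beyond its arguments, but the stack may hold
    leftovers of earlier computations. *)
Fixpoint zero_regs (k n : nat) : cmd :=
  if n is n'.+1 then Seq (Assign k (Const 0)) (zero_regs k.+1 n') else Skip.

Lemma run_zero_regs w M k n s : exists s', run w M (zero_regs k n) s s' /\
  forall i, reg s' i = if k <= i < k + n then 0 else reg s i.
Proof.
elim: n k s => [|n IHn] k s.
  exists s; split; first exact: RunSkip.
  by move=> i; case: ifP => //; lia.
have [s' [r e]] := IHn k.+1 (set_nth 0 s k 0); exists s'; split.
  by apply: RunSeq r; apply: (@RunAssign _ _ _ (Const 0)).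
by move=> i; rewrite e reg_set; do ?case: ifP; lia.
Qed.

Section Call.
Variables (X : Type) (P : X -> seq bool -> Prop) (env : X -> seq nat).
Variable M : X -> nat.

Fixpoint all_computed (As : seq (X -> nat)) : Prop :=
  if As is A :: As' then computes P env M A /\ all_computed As' else True.

Lemma comps_block As : all_computed As ->
  exists c : seq nat -> nat -> cmd, forall x w l k s,
    P x w -> all (fun r => r < k) l -> map (reg s) l = env x ->
    all (fun a => a <= M x) [seq A x | A <- As] /\
    exists s', [/\ run w (M x) (c l k) s s',
      forall j, j < size As -> reg s' (k + j) = nth 0 [seq A x | A <- As] j
      & forall i, i < k -> reg s' i = reg s i].
Proof.
elim: As => [_|A As IHAs [[ca caP] /IHAs[cs csP]]].
  exists (fun _ _ => Skip) => x w l k s _ _ _; split=> //.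
  by exists s; split=> //; apply: RunSkip.
exists (fun l k => Seq (ca l k) (cs l k.+1)) => x w l k s Px ltl eql.
have [leA [s1 [r1 v1 e1]]] := caP _ _ _ _ _ Px ltl eql.
have [||leB [s2 [r2 v2 e2]]] := csP _ w l k.+1 s1 Px.
- exact: all_ltW ltl.
- by rewrite (eq_map_reg ltl e1).
split; first by rewrite /= leA.
exists s2; split; first exact: RunSeq r1 r2.
- move=> [_|j ltj]; first by rewrite addn0 e2.
  by rewrite addnS -addSn v2.
- by move=> i lti; rewrite e2 ?e1 // ltnW.
Qed.

(** Arbitrary programs as subroutines, on arguments [As] and an input that exists only as a
    function. Addresses read are register contents, hence at most [M0], and bits have to be
    computable only up to there. *)
Lemma computes_call (c : cmd) (o : nat) (As : seq (X -> nat))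
    (inp : X -> seq bool) (M0 F : X -> nat) :
  all_computed As ->
  computes (fun (p : X * nat) w => P p.1 w /\ p.2 <= M0 p.1)
       (fun p => p.2 :: env p.1) (fun p => M p.1)
       (fun p => nth 2 (map nat_of_bool (inp p.1)) p.2) ->
  (forall x w, P x w -> M0 x <= M x) ->
  (forall x w, P x w -> all (fun a => a <= M0 x) [seq A x | A <- As]) ->
  (forall x w, P x w -> exists s',
     run (inp x) (M0 x) c [seq A x | A <- As] s' /\ reg s' o = F x) ->
  computes P env M F.
Proof.
move=> /comps_block[cs csP] [ci ciP] leM leAs runP.
pose R := maxn (regs c) (maxn (size As) o.+1).
exists (fun l k => Seq (cs l k) (Seq (zero_regs (k + size As) (R - size As))
  (Seq (sim (fun r => ci (r :: l) (k + R)) k (k + R) c)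
  (Seq (Assign (k + R) (Const 0)) (Assign k (Binop OpSub (k + o) (k + R))))))).
move=> x w l k s Px ltl eql.
have [_ [s1 [r1 v1 e1]]] := csP _ _ _ _ _ Px ltl eql.
have [s2 [r2 e2]] := run_zero_regs w (M x) (k + size As) (R - size As) s1.
have [sf [rf vf]] := runP _ _ Px.
have le0 : forall i, reg [seq A x | A <- As] i <= M0 x.
  move=> i; have [lti|gei] := ltnP i (size As); last first.
    by rewrite /reg nth_default // size_map.
  by move/allP: (leAs _ _ Px); apply; rewrite mem_nth // size_map.
have e2' i : i < k -> reg s2 i = reg s i.
  by move=> lti; rewrite e2 e1 //; case: ifP => //; lia.
have leF : F x <= M x.
  by rewrite -vf; apply: leq_trans (run_le rf le0 o) (leM _ _ Px).
split=> //.
have leR : regs c <= R by rewrite leq_maxl.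
have [||s3 [r3 [SS3 e3]]] := @run_sim w (inp x) (M x) (M0 x) k R
    (fun r => ci (r :: l) (k + R)) s (leM _ _ Px) _ _ _ _ rf leR le0 s2.
- move=> r S /andP[ger ltr] leS eS.
  have [|||_ [S' [rS vS eS']]] := ciP (x, reg S r) w (r :: l) (k + R) S.
  + by [].
  + by rewrite /= ltr; apply: all_ltW ltl; lia.
  + by rewrite /= (eq_map_reg ltl eS) eql.
  by exists S'.
- split=> // i lti; rewrite e2.
  have [lti'|gei] := ltnP i (size As).
    rewrite v1 // (_ : (_ <= _ < _) = false) //; lia.
  by rewrite ifT; [rewrite /reg nth_default // size_map|lia].
set s4 := set_nth 0 s3 (k + R) 0.
have lto : o < R by lia.
have q : rhs_sem w s4 (Binop OpSub (k + o) (k + R)) = F x.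
  by rewrite /= !reg_set eqxx ltn_eqF ?subn0 ?SS3 //; lia.
exists (set_nth 0 s4 k (F x)); split.
- apply: RunSeq r1 _; apply: RunSeq r2 _; apply: RunSeq r3 _.
  apply: (RunSeq (s2 := s4)); first exact: (@RunAssign _ _ _ (Const 0)).
  by rewrite -q; apply: RunAssign; rewrite q.
- by rewrite reg_set eqxx.
- by move=> i lti; rewrite !reg_set !ltn_eqF ?e3 //; lia.
Qed.

End Call.

(** * Arithmetic *)

Definition digit (b a i : nat) : nat := (a %/ b ^ i) %% b.

Lemma sum_iteri n F : \sum_(0 <= i < n) F i = iteri n (fun i a => a + F i) 0.
Proof.
by elim: n => [|n IHn]; [rewrite big_geq | rewrite big_nat_recr //= IHn].
Qed.

Lemma leq_sum_term n F i : i < n -> F i <= \sum_(0 <= j < n) F j.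
Proof.
by move=> lti; rewrite (big_cat_nat (n := i.+1)) //= big_nat_recr //=; lia.
Qed.

Lemma sum_bool_le n (p : pred nat) : \sum_(0 <= i < n) p i <= n.
Proof.
rewrite -[X in _ <= X]muln1 -[X in X * 1]subn0 -sum_nat_const_nat.
by apply: leq_sum => i _; apply: leq_b1.
Qed.

Lemma expn_iteri a n : a ^ n = iteri n (fun _ b => b * a) 1.
Proof. by elim: n => //= n <-; rewrite expnSr. Qed.

(** * Sums, powers, digits and Boolean operations within a bound on the values *)

Section Derived.
Variables (X : Type) (P : X -> seq bool -> Prop) (env : X -> seq nat).
Variable M : X -> nat.
Implicit Types (A B F H : X -> nat) (a b : X -> bool).

Lemma computes_up (Q : X * nat -> seq bool -> Prop) F :
  (forall p w, Q p w -> P p.1 w) -> computes P env M F ->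
  computes Q (fun p => p.2 :: env p.1) (fun p => M p.1) (fun p => F p.1).
Proof.
move=> QP; apply: (@computes_weak X P env M _ _ _ _ fst 1) => p w /QP Pp.
by split=> //=; rewrite drop0.
Qed.

Lemma computes_top (Q : X * nat -> seq bool -> Prop) :
  (forall p w, Q p w -> p.2 <= M p.1) ->
  computes Q (fun p => p.2 :: env p.1) (fun p => M p.1) (fun p => p.2).
Proof. by move=> leM; apply: (@computes_var _ _ _ _ 0) => p w /leM. Qed.

Lemma computes_sum H (G : X -> nat -> nat) :
  computes P env M H ->
  computes (fun (p : X * nat) w => P p.1 w /\ p.2 < H p.1 <= M p.1)
       (fun p => p.2 :: env p.1) (fun p => M p.1) (fun p => G p.1 p.2) ->
  (forall x w, P x w -> \sum_(0 <= i < H x) G x i <= M x) ->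
  computes P env M (fun x => \sum_(0 <= i < H x) G x i).
Proof.
move=> cH cG leM.
apply: (@computes_ext _ _ _ _ (fun x => iteri (H x) (fun i c => c + G x i) 0)).
  by move=> x w _; rewrite sum_iteri.
apply: computes_fold => //; first exact: computes_const.
apply: computes_add.
- by apply: (@computes_var _ _ _ _ 0) => p w [].
- apply: (@computes_weak _ _ _ _ _ _ _ _ (fun p => (p.1.1, p.1.2)) 1 _ _ cG).
  by move=> p w [? ? _ _]; split=> //=; rewrite drop0.
- move=> [[x i] c] w /= [Px /andP[lti _] _ ->].
  apply: leq_trans (leM _ _ Px); rewrite -sum_iteri -big_nat_recr //=.
  by rewrite (@big_cat_nat _ _ _ i.+1 0 (H x)) //= leq_addr.
Qed.

(** Positivity of the base keeps the intermediate powers below the final one. *)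
Lemma computes_pow A B : computes P env M A -> computes P env M B ->
  (forall x w, P x w -> 0 < A x /\ A x ^ B x <= M x) ->
  computes P env M (fun x => A x ^ B x).
Proof.
move=> cA cB leM.
apply: (@computes_ext _ _ _ _ (fun x => iteri (B x) (fun _ c => c * A x) 1)).
  by move=> x w _; rewrite expn_iteri.
apply: computes_fold => //.
  apply: computes_const => x w /leM[A0 le]; apply: leq_trans le.
  by rewrite expn_gt0 A0.
apply: computes_mul.
- by apply: (@computes_var _ _ _ _ 0) => p w [].
- apply: (@computes_weak _ _ _ _ _ _ _ _ (fun p => p.1.1) 2 _ _ cA).
  by move=> p w [? ? _ _]; split=> //=; rewrite drop0.
- move=> [[x i] c] w /= [Px /andP[lti _] _ ->].
  have [A0 le] := leM _ _ Px; apply: leq_trans le.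
  by rewrite -expn_iteri -expnSr leq_pexp2l.
Qed.

Lemma computes_digit A B F : computes P env M A -> computes P env M B ->
  computes P env M F ->
  (forall x w, P x w -> 0 < A x /\ A x ^ F x <= M x) ->
  computes P env M (fun x => digit (A x) (B x) (F x)).
Proof. by move=> cA cB cF le; apply/computes_mod/cA/computes_div/computes_pow. Qed.

Hypothesis M_gt0 : forall x w, P x w -> 0 < M x.

Lemma computes_leq A B : computes P env M A -> computes P env M B ->
  computes P env M (fun x => A x <= B x).
Proof.
move=> cA cB; apply: (@computes_ext _ _ _ _ (fun x => 1 - (A x - B x))).
  by move=> x w _; lia.
by apply/computes_sub/computes_sub => //; apply: computes_const.
Qed.

Lemma computes_not a : computes P env M a -> computes P env M (fun x => ~~ a x).
Proof.
move=> ca; apply: (@computes_ext _ _ _ _ (fun x => 1 - a x)).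
  by move=> x w _; case: (a x).
by apply: computes_sub => //; apply: computes_const.
Qed.

Lemma computes_lt A B : computes P env M A -> computes P env M B ->
  computes P env M (fun x => A x < B x).
Proof.
move=> cA cB; apply: (@computes_ext _ _ _ _ (fun x => ~~ (B x <= A x))).
  by move=> x w _; rewrite ltnNge.
exact/computes_not/computes_leq.
Qed.

Lemma computes_gt0 A : computes P env M A -> computes P env M (fun x => 0 < A x).
Proof. by apply: computes_lt; apply: computes_const. Qed.

Lemma computes_and a b : computes P env M a -> computes P env M b ->
  computes P env M (fun x => a x && b x).
Proof.
move=> ca cb; apply: (@computes_ext _ _ _ _ (fun x => a x * b x)).
  by move=> x w _; rewrite mulnb.
by apply: computes_mul => // x w /M_gt0; case: (a x); case: (b x).
Qed.

Lemma computes_or a b : computes P env M a -> computes P env M b ->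
  computes P env M (fun x => a x || b x).
Proof.
move=> ca cb; apply: (@computes_ext _ _ _ _ (fun x => ~~ (~~ a x && ~~ b x))).
  by move=> x w _; rewrite negb_and !negbK.
by apply/computes_not/computes_and; apply: computes_not.
Qed.

Lemma computes_eq A B : computes P env M A -> computes P env M B ->
  computes P env M (fun x => A x == B x).
Proof.
move=> cA cB; apply: (@computes_ext _ _ _ _ (fun x => (A x <= B x) && (B x <= A x))).
  by move=> x w _; rewrite eqn_leq.
by apply: computes_and; apply: computes_leq.
Qed.

Lemma computes_if a A B : computes P env M a ->
  computes P env M A -> computes P env M B ->
  computes P env M (fun x => if a x then A x else B x).
Proof.
move=> ca cA cB.
apply: (@computes_ext _ _ _ _ (fun x => a x * A x + ~~ a x * B x)).
  by move=> x w _; case: (a x); lia.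
apply: (@computes_bin _ _ _ _ OpAdd).
- by apply: (@computes_bin _ _ _ _ OpMul) => //= x w _ _; case: (a x); lia.
- apply: (@computes_bin _ _ _ _ OpMul) => //=; first exact: computes_not.
  by move=> x w _ _; case: (a x); lia.
- by move=> x w _ /=; case: (a x); lia.
Qed.

End Derived.

(** As [M] is an arbitrary function, it expresses termination only; as the input word is
    unrestricted, the result cannot depend on it. *)
Definition computable_in (X : Type) (env : X -> seq nat) (F : X -> nat) : Prop :=
  exists M, computes (fun _ _ => True) env M F.

Section Total.
Variables (X : Type) (env : X -> seq nat).
Implicit Types (A B F H : X -> nat) (a b : X -> bool).
Let P (x : X) (w : seq bool) := True.

Lemma computes_mono M M' F : (forall x, M x <= M' x) ->
  computes P env M F -> computes P env M' F.
Proof.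
move=> leM; apply: (@computes_weak _ _ _ _ _ _ _ _ id 0) => x w _.
by rewrite drop0.
Qed.

Lemma computable_ext F F' : F =1 F' -> computable_in env F -> computable_in env F'.
Proof. by move=> eqF [M cF]; exists M; apply: computes_ext cF => x w _. Qed.

Lemma computable_var i F : (forall x, i < size (env x) /\ nth 0 (env x) i = F x) ->
  computable_in env F.
Proof. by move=> iP; exists F; apply: (@computes_var _ _ _ _ i) => x w _; case: (iP x). Qed.

Lemma computable_const n : computable_in env (fun=> n).
Proof. by exists (fun=> n); apply: computes_const. Qed.

(** The bound being free here, adding one and [F x] itself to it meets all the side conditions of
    the bounded versions. *)
Lemma computable_lift2 A B F : computable_in env A -> computable_in env B ->
  (forall M, (forall x, 0 < M x) -> (forall x, F x <= M x) ->
     computes P env M A -> computes P env M B -> computes P env M F) ->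
  computable_in env F.
Proof.
move=> [MA cA] [MB cB] cF; exists (fun x => (MA x + MB x + F x).+1).
apply: cF => //; last 2 first.
- by apply: computes_mono cA => x; lia.
- by apply: computes_mono cB => x; lia.
- by move=> x; lia.
Qed.

Lemma computable_add A B : computable_in env A -> computable_in env B ->
  computable_in env (fun x => A x + B x).
Proof. by move=> cA cB; apply: (computable_lift2 cA cB) => M *; apply: computes_add. Qed.

Lemma computable_mul A B : computable_in env A -> computable_in env B ->
  computable_in env (fun x => A x * B x).
Proof. by move=> cA cB; apply: (computable_lift2 cA cB) => M *; apply: computes_mul. Qed.

Lemma computable_sub A B : computable_in env A -> computable_in env B ->
  computable_in env (fun x => A x - B x).
Proof. by move=> cA cB; apply: (computable_lift2 cA cB) => M *; apply: computes_sub. Qed.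

Lemma computable_div A B : computable_in env A -> computable_in env B ->
  computable_in env (fun x => A x %/ B x).
Proof. by move=> cA cB; apply: (computable_lift2 cA cB) => M *; apply: computes_div. Qed.

Lemma computable_mod A B : computable_in env A -> computable_in env B ->
  computable_in env (fun x => A x %% B x).
Proof. by move=> cA cB; apply: (computable_lift2 cA cB) => M *; apply: computes_mod. Qed.

Lemma computable_pow A B : (forall x, 0 < A x) ->
  computable_in env A -> computable_in env B ->
  computable_in env (fun x => A x ^ B x).
Proof.
by move=> A0 cA cB; apply: (computable_lift2 cA cB) => M *; apply: computes_pow.
Qed.

Lemma computable_digit A B F : (forall x, 0 < A x) ->
  computable_in env A -> computable_in env B -> computable_in env F ->
  computable_in env (fun x => digit (A x) (B x) (F x)).
Proof. by move=> A0 cA cB cF; apply/computable_mod/cA/computable_div/computable_pow. Qed.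

Lemma computable_leq A B : computable_in env A -> computable_in env B ->
  computable_in env (fun x => A x <= B x).
Proof. by move=> cA cB; apply: (computable_lift2 cA cB) => M *; apply: computes_leq. Qed.

Lemma computable_lt A B : computable_in env A -> computable_in env B ->
  computable_in env (fun x => A x < B x).
Proof. by move=> cA cB; apply: (computable_lift2 cA cB) => M *; apply: computes_lt. Qed.

Lemma computable_eq A B : computable_in env A -> computable_in env B ->
  computable_in env (fun x => A x == B x).
Proof. by move=> cA cB; apply: (computable_lift2 cA cB) => M *; apply: computes_eq. Qed.

Lemma computable_and a b : computable_in env a -> computable_in env b ->
  computable_in env (fun x => a x && b x).
Proof. by move=> cA cB; apply: (computable_lift2 cA cB) => M *; apply: computes_and. Qed.

Lemma computable_or a b : computable_in env a -> computable_in env b ->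
  computable_in env (fun x => a x || b x).
Proof. by move=> cA cB; apply: (computable_lift2 cA cB) => M *; apply: computes_or. Qed.

Lemma computable_not a : computable_in env a -> computable_in env (fun x => ~~ a x).
Proof. by move=> cA; apply: (computable_lift2 cA cA) => M *; apply: computes_not. Qed.

Lemma computable_if a A B : computable_in env a -> computable_in env A ->
  computable_in env B -> computable_in env (fun x => if a x then A x else B x).
Proof.
move=> ca cA cB; apply: (@computable_ext (fun x => a x * A x + ~~ a x * B x)).
  by move=> x; case: (a x); lia.
by apply: computable_add; apply: computable_mul => //; apply: computable_not.
Qed.

Lemma computable_sum H (G : X -> nat -> nat) :
  computable_in env H ->
  computable_in (fun p : X * nat => p.2 :: env p.1) (fun p => G p.1 p.2) ->
  computable_in env (fun x => \sum_(0 <= i < H x) G x i).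
Proof.
move=> [MH cH] [MG cG].
(* The bound may not depend on the summation index, so the bounds for all terms are added. *)
pose M x := MH x + \sum_(0 <= i < H x) G x i + \sum_(0 <= i < H x) MG (x, i).
exists M; apply: computes_sum.
- by apply: computes_mono cH => x; rewrite /M; lia.
- apply: (@computes_weak _ _ _ _ _ _ _ _ id 0 _ _ cG) => -[x i] w /= [_ /andP[lti _]].
  by split=> //; have := leq_sum_term (fun j => MG (x, j)) lti; rewrite /M; lia.
- by move=> x w _; rewrite /M; lia.
Qed.

Lemma computable_up F : computable_in env F ->
  computable_in (fun p : X * nat => p.2 :: env p.1) (fun p => F p.1).
Proof. by case=> M cF; exists (fun p => M p.1); apply: computes_up cF. Qed.

End Total.

Lemma computable_top (X : Type) (env : X -> seq nat) :
  computable_in (fun p : X * nat => p.2 :: env p.1) (fun p => p.2).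
Proof. by apply: (@computable_var _ _ 0). Qed.

Fixpoint all_computable (X : Type) (env : X -> seq nat) (As : seq (X -> nat)) :=
  if As is A :: As' then computable_in env A /\ all_computable env As' else True.

Lemma all_computed_bound (X : Type) (env : X -> seq nat) As :
  all_computable env As ->
  exists M, forall M', (forall x, M x <= M' x) ->
    all_computed (fun _ _ => True) env M' As.
Proof.
elim: As => [_|A As IHAs [[MA cA] /IHAs[MAs cAs]]]; first by exists (fun=> 0).
exists (fun x => MA x + MAs x) => M' leM' /=; split.
  by apply: computes_mono cA => x; apply: leq_trans (leM' x); apply: leq_addr.
by apply: cAs => x; apply: leq_trans (leM' x); apply: leq_addl.
Qed.

Lemma leq_sumn (s : seq nat) : all (fun a => a <= sumn s) s.
Proof.
elim: s => //= a s IHs; rewrite leq_addr /=.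
by apply: sub_all IHs => b leb; apply: leq_trans leb (leq_addl _ _).
Qed.

Lemma computable_call (X : Type) (env : X -> seq nat) (c : cmd) (o : nat)
    (As : seq (X -> nat)) (inp : X -> seq bool) (F : X -> nat) :
  all_computable env As ->
  computable_in (fun p : X * nat => p.2 :: env p.1)
    (fun p => nth 2 (map nat_of_bool (inp p.1)) p.2) ->
  (forall x, exists M s',
     run (inp x) M c [seq A x | A <- As] s' /\ reg s' o = F x) ->
  computable_in env F.
Proof.
move=> /all_computed_bound[MA cA] [MI cI] /functional_choice[M0 runP].
pose M1 x := M0 x + sumn [seq A x | A <- As].
(* Any address up to [M1 x] may be read, so the costs of computing all these bits are added. *)
pose M x := M1 x + MA x + \sum_(0 <= a < (M1 x).+1) MI (x, a).
exists M; apply: (@computes_call _ _ _ _ c o As inp M1).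
- by apply: cA => x; rewrite /M; lia.
- apply: (@computes_weak _ _ _ _ _ _ _ _ id 0 _ _ cI) => -[x a] w /= [_ lea].
  split=> //; rewrite -ltnS in lea.
  by have := leq_sum_term (fun j => MI (x, j)) lea; rewrite /M; lia.
- by move=> x w _; rewrite /M; lia.
- move=> x w _; apply: sub_all (leq_sumn _) => a lea.
  exact: leq_trans lea (leq_addl _ _).
- move=> x w _; have [s' [r e]] := runP x; exists s'; split=> //.
  by apply: run_mono r; apply: leq_addr.
Qed.

Definition env2 (p : nat * nat) : seq nat := [:: p.1; p.2].

(* [T] bounds all values assigned by some program for [F] on the arguments: it is
   the total accumulated by the instrumented program. *)
Lemma computable_cost (F : nat -> nat -> nat) :
  computable_in env2 (fun p => F p.1 p.2) ->
  exists T : nat -> nat -> nat, computable_in env2 (fun p => T p.1 p.2) /\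
    forall (X : Type) (P : X -> seq bool -> Prop) env M (A B : X -> nat),
    computes P env M A -> computes P env M B ->
    (forall x w, P x w -> T (A x) (B x) <= M x) ->
    computes P env M (fun x => F (A x) (B x)).
Proof.
case=> M [cF cFP]; set c := cF [:: 0; 1] 2.
(* Beyond the registers of [c] and the two arguments, so that the total starts at 0. *)
pose t := maxn (regs c) 2.
have runP (p : nat * nat) : exists K, exists s s',
    [/\ run [::] K c (env2 p) s, reg s 2 = F p.1 p.2,
        run [::] K (instr t c) (env2 p) s' & reg s' t = K].
  have [||_ [s [r e _]]] := cFP p [::] [:: 0; 1] 2 (env2 p) I => //.
  have [|//|K [s' [r1 r2 e1 _]]] := run_instr r (t := t) (S := env2 p).
    exact: leq_maxl.
  have z : reg (env2 p) t = 0 by rewrite /reg nth_default // leq_maxr.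
  by rewrite z in r2 e1; exists K, s, s'.
have [K KP] := functional_choice _ runP.
have cvar i : i < 2 -> computable_in env2 (fun p => nth 0 (env2 p) i).
  by move=> lti; apply: (@computable_var _ _ i).
(* Although [K] was obtained by choice, it is computable: it is the output of the instrumented
   program. *)
have cK : computable_in env2 K.
  apply: (@computable_call _ _ (instr t c) t [:: fst; snd] (fun=> [::])).
  - by do !split; [apply: (cvar 0)|apply: (cvar 1)].
  - apply: computable_ext (computable_const _ 2) => p.
    by rewrite nth_nil.
  - by move=> p; have [s [s' [_ _ r e]]] := KP p; exists (K p), s'.
(* The arguments have to be stored too, and 2 is the end marker returned by every reading of the
   empty input. *)
exists (fun a b => K (a, b) + (a + b + 2)); split.
  apply: (@computable_ext _ _ (fun p => K p + (p.1 + p.2 + 2))); first by case.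
  apply: computable_add => //; apply: computable_add; last exact: computable_const.
  by apply: computable_add; [apply: (cvar 0)|apply: (cvar 1)].
move=> X P env M' A B cA cB leM.
apply: (@computes_call _ _ _ _ c 2 [:: A; B] (fun=> [::])
          (fun x => K (A x, B x) + (A x + B x + 2))) => //.
- apply: (@computes_ext _ _ _ _ (fun=> 2)); first by move=> p w _; rewrite nth_nil.
  by apply: computes_const => p w [/leM]; lia.
- by move=> x w _ /=; lia.
- move=> x w _; have [s [s' [r e _ _]]] := KP (A x, B x).
  by exists s; split=> //; apply: run_mono r; apply: leq_addr.
Qed.

Lemma computable_app2 (X : Type) (env : X -> seq nat) (F : nat -> nat -> nat) A B :
  computable_in env2 (fun p => F p.1 p.2) ->
  computable_in env A -> computable_in env B ->
  computable_in env (fun x => F (A x) (B x)).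
Proof.
case/computable_cost=> T [_ TP] [MA cA] [MB cB].
exists (fun x => MA x + MB x + T (A x) (B x)); apply: TP.
- by apply: computes_mono cA => x; lia.
- by apply: computes_mono cB => x; lia.
- by move=> x w _; lia.
Qed.

(** * From bounded values to computable functions and logarithmic space *)

Lemma computable_of_in (F : nat -> nat) :
  computable_in (fun n => [:: n]) F -> computable F.
Proof.
case=> M [cF cFP].
exists (Seq (cF [:: 0] 1) (Seq (Assign 2 (Const 0)) (Assign 0 (Binop OpSub 1 2)))).
move=> n; have [||leF [s [r e _]]] := cFP n [::] [:: 0] 1 [:: n] I => //.
set c := Seq _ _.
pose s1 := set_nth 0 s 2 0.
have q : rhs_sem [::] s1 (Binop OpSub 1 2) = F n.
  by rewrite /= !reg_set /= subn0 e.
have run_c : run [::] (M n + n) c [:: n] (set_nth 0 s1 0 (F n)).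
  apply: RunSeq (run_mono (leq_addr _ _) r) _; apply: (RunSeq (s2 := s1)).
    exact: (@RunAssign _ _ _ (Const 0)).
  by rewrite -q; apply: RunAssign; rewrite q; lia.
have [|||ex _] := run_exec (R := maxn (regs c) 1) run_c (leqnn _).
- exact: leq_maxl.
- exact: leq_maxr.
- by case=> [|i] /=; [apply: leq_addl|rewrite /reg /= nth_nil].
by eexists _, _; split; [exact: ex|rewrite reg_set].
Qed.

Lemma bitsize_bound F0 n M : M <= F0 + 2 * n + 2 ->
  bitsize M <= F0 + 3 + trunc_log 2 n.
Proof.
move=> leM; apply: up_log_min => //.
have lt1 : F0 < 2 ^ F0 by apply: ltn_expl.
have lt2 : n < 2 ^ (trunc_log 2 n).+1 by apply: trunc_log_ltn.
set t := trunc_log 2 n in lt2 *; rewrite !expnD.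
have : 0 < 2 ^ t by rewrite expn_gt0.
move: lt2; rewrite expnS; move: (2 ^ t) (2 ^ F0) lt1 => u v; nia.
Qed.

(** The factor of the logarithm is the number [R] of registers: each of them holds a value linear in
    the input size up to a term in the parameter, as in [bitsize_bound]. *)
Lemma para_L_of_computes (Q : param_problem) (M F : instance Q -> nat)
    (F0 : nat -> nat) :
  computable_in (fun k => [:: k]) F0 ->
  (forall x, M x <= F0 (param x) + 2 * size (encode x) + 2) ->
  computes (fun x w => w = encode x) (fun=> [::]) M F ->
  (forall x, F x != 0 <-> yes x) -> para_L Q.
Proof.
move=> cF0 leM [c cP] FP; pose R := regs (c [::] 0).
exists (c [::] 0), (fun k => R * (F0 k + 3)), R; split.
  apply: computable_of_in; apply: computable_mul; first exact: computable_const.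
  by apply: computable_add => //; apply: computable_const.
move=> x; have [//|//|leF [s [r e _]]] := cP x _ [::] 0 [::] erefl.
exists s; last by rewrite e; apply: FP.
have le : R * bitsize (M x) <=
    R * (F0 (param x) + 3) + R * trunc_log 2 (size (encode x)).
  by rewrite -mulnDr leq_mul2l bitsize_bound ?orbT.
have [|||ex _] := run_exec r le => //.
by move=> i; rewrite /reg nth_nil.
Qed.

(** * Deletion in graphs with labelled vertices *)

Definition embedding (H G : sgraph) (f : H -> G) : Prop :=
  injective f /\ forall x y, adj (f x) (f y) = adj x y.

Lemma embedding_comp (K H G : sgraph) (f : H -> G) (g : K -> H) :
  embedding f -> embedding g -> embedding (f \o g).
Proof.
case=> fI fE [gI gE]; split; first exact: inj_comp.
by move=> x y; rewrite /= fE gE.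
Qed.

Lemma embedding_val (G : sgraph) (S : {set G}) :
  embedding (val : induced S -> G).
Proof. by split=> //; apply: val_inj. Qed.

Lemma isomorphic_sym G H : isomorphic G H -> isomorphic H G.
Proof.
case=> h [h' hK h'K] hE; exists h'; first by exists h.
by move=> x y; rewrite -hE !h'K.
Qed.

Lemma card_induced (G : sgraph) (S : {set G}) : #|induced S| = #|S|.
Proof. by rewrite card_sig; apply: eq_card => x; rewrite !inE. Qed.

Lemma isomorphic_image (H G : sgraph) (f : H -> G) :
  embedding f -> isomorphic H (induced (f @: [set: H])).
Proof.
case=> fI fE; have fP x : f x \in f @: [set: H] by rewrite imset_f.
exists (fun x => exist _ (f x) (fP x) : induced _); last by move=> x y /=.
apply: inj_card_bij; first by move=> x y [/fI].
by rewrite card_induced card_imset // cardsT.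
Qed.

Section Pi.
Variable Pi : sgraph -> Prop.
Hypothesis PiC : graph_class Pi.

Lemma free_of_embedding (G : sgraph) : free_of Pi G <->
  forall (H : sgraph) (f : H -> G), embedding f -> ~ Pi H.
Proof.
split=> [frG H f fE PH|frG S]; last exact/frG/embedding_val.
exact: frG (PiC (isomorphic_image fE) PH).
Qed.

Lemma free_of_remove (G : sgraph) (S : {set G}) : free_of Pi (remove S) <->
  forall (H : sgraph) (f : H -> G),
    embedding f -> (forall x, f x \notin S) -> ~ Pi H.
Proof.
rewrite free_of_embedding; split=> [frG H f [fI fE] fS|frG H f fE]; last first.
  apply: (frG H (val \o f)); first exact: embedding_comp (embedding_val _) fE.
  by move=> x; have := valP (f x); rewrite inE.
have fP x : f x \in ~: S by rewrite inE.
apply: (frG H (fun x => exist _ (f x) (fP x) : remove S)); split=> //.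
by move=> x y [/fI].
Qed.

Lemma minimal_embedding (H : sgraph) : Pi H ->
  exists (K : sgraph) (f : K -> H), embedding f /\ vertex_minimal Pi K.
Proof.
have [n leH] := ubnP #|H|; elim: n H leH => // n IHn H leH PH.
have [[S [prS PS]]|minH] := classic (exists S : {set H},
    S \proper [set: H] /\ Pi (induced S)).
  have [|K [f [fE minK]]] := IHn (induced S) _ PS.
    by rewrite card_induced; move: (proper_card prS); rewrite cardsT; lia.
  exists K, (val \o f); split=> //.
  exact: embedding_comp (embedding_val _) fE.
exists H, id; split=> //; split=> // S prS PS.
by apply: minH; exists S.
Qed.

End Pi.

Lemma vc_number_le (G : sgraph) (C : {set G}) :
  vertex_cover C -> vc_number G <= #|C|.
Proof.
move=> covC; rewrite /vc_number; case: arg_minnP => [|B _]; last exact.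
by apply/forallP=> x; apply/forallP=> y; rewrite !inE implybT.
Qed.

Lemma vc_number_ex (G : sgraph) :
  exists2 C : {set G}, vertex_cover C & #|C| = vc_number G.
Proof.
rewrite /vc_number; case: arg_minnP => [|B covB _]; last by exists B.
by apply/forallP=> x; apply/forallP=> y; rewrite !inE implybT.
Qed.

(** The preimage of a cover is a cover, and by injectivity it is no larger. *)
Lemma vc_number_embedding (H G : sgraph) (f : H -> G) (C : {set G}) :
  embedding f -> vertex_cover C -> vc_number H <= #|C|.
Proof.
case=> fI fE /forallP covC; apply: (@leq_trans #|f @^-1: C|).
  apply: vc_number_le; apply/forallP=> x; apply/forallP=> y.
  by rewrite !inE -fE; have /forallP := covC (f x); apply.
rewrite -(card_imset _ fI); apply: subset_leq_card.
by apply/subsetP=> _ /imsetP[x + ->]; rewrite inE.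
Qed.

Section WordGraph.
Variables (e : rel nat) (q : nat) (w : nat -> nat).

(** The relation on labels need not be symmetric: [label_adj] looks up the cover position of its
    second argument in the neighbourhood of the first. Testing [i != j] on positions lets equal
    labels occur several times. *)
Definition word_adj : rel 'I_q :=
  fun i j => (i != j) && (e (w i) (w j) || e (w j) (w i)).

Lemma word_adj_sym : symmetric word_adj.
Proof. by move=> i j; rewrite /word_adj eq_sym orbC. Qed.

Lemma word_adj_irr : irreflexive word_adj.
Proof. by move=> i; rewrite /word_adj eqxx. Qed.

Definition word_graph : sgraph := SGraph word_adj word_adj_sym word_adj_irr.
End WordGraph.

Definition letter_count (w : nat -> nat) (q l : nat) : nat :=
  \sum_(0 <= i < q) (w i == l).

Lemma letter_count_lt w l i q : w i = l -> i < q ->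
  letter_count w i l < letter_count w q l.
Proof.
move=> wi lti; rewrite /letter_count [X in _ < X](big_cat_nat (n := i.+1)) //=.
by rewrite big_nat_recr //= wi eqxx; lia.
Qed.

Section Deletion.
Variables (Pi : sgraph -> Prop) (G : sgraph) (L N : nat) (lab : G -> nat).
Variable e : rel nat.
Hypothesis PiC : graph_class Pi.
Hypothesis lab_lt : forall x, lab x < L.
Hypothesis adj_lab : forall x y, x != y ->
  adj x y = e (lab x) (lab y) || e (lab y) (lab x).
Hypothesis minimal_le : forall (K : sgraph) (f : K -> G), embedding f ->
  vertex_minimal Pi K -> #|K| <= N.

Let cls l : {set G} := [set x | lab x == l].

(* [r l] is the number of vertices labelled [l] that are kept; [N] stands for
   keeping them all, since at most [N] of them are seen by a minimal graph. *)
Definition allowed (r : nat -> nat) : Prop :=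
  forall q w, q <= N -> (forall i, i < q -> w i < L) ->
    (forall l, l < L -> letter_count w q l <= r l) -> ~ Pi (word_graph e q w).

Definition deletion_cost (r : nat -> nat) : nat :=
  \sum_(0 <= l < L) (r l < N) * (#|cls l| - r l).

(** A position goes to the remaining vertex of its class whose index is the number of earlier
    occurrences of the same letter; two positions with the same letter thus get different
    vertices. *)
Lemma word_embedding (S : {set G}) q w :
  (forall i, i < q -> w i < L) ->
  (forall l, l < L -> letter_count w q l <= #|cls l :\: S|) ->
  exists f : word_graph e q w -> G, embedding f /\ forall i, f i \notin S.
Proof.
move=> wL leS; pose rk (i : 'I_q) := letter_count w i (w i).
have rkP i : rk i < #|cls (w i) :\: S|.
  exact: leq_trans (letter_count_lt _ _) (leS _ (wL _ _)).
pose f (i : word_graph e q w) := enum_val (Ordinal (rkP i)) : G.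
have fP i : f i \in cls (w i) :\: S by apply: enum_valP.
have fL i : lab (f i) = w i.
  by have := fP i; rewrite !inE => /andP[_ /eqP].
have fI : injective f.
  move=> i j eqf; have eqw : w i = w j by rewrite -!fL eqf.
  have idx (k : 'I_q) : index (f k) (enum (cls (w k) :\: S)) = rk k.
    rewrite /f (enum_val_nth (f k)) index_uniq ?enum_uniq //.
    by rewrite -cardE.
  have eqr : rk i = rk j by rewrite -!idx eqf eqw.
  apply: val_inj => /=; have [lt|lt|//] := ltngtP i j.
    have := @letter_count_lt w _ _ _ eqw lt.
    by rewrite -/(rk j) -eqr /rk eqw ltnn.
  have := @letter_count_lt w _ _ _ (esym eqw) lt.
  by rewrite -/(rk i) eqr /rk eqw ltnn.
exists f; split; last by move=> i; have := fP i; rewrite inE => /andP[].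
split=> // i j; rewrite /= /word_adj; have [->|ne] := eqVneq i j.
  exact: adj_irr.
by rewrite adj_lab ?(inj_eq fI) // !fL.
Qed.

Lemma deletion_allowed k : free_deletion Pi G k ->
  exists r, [/\ forall l, r l <= N, allowed r & deletion_cost r <= k].
Proof.
case=> S [leS /(free_of_remove PiC) frS].
(* A class with at least [N] survivors costs nothing, and any other costs exactly its part in [S].
   Each vertex has one label below [L], so these parts add up to [#|S|]. *)
exists (fun l => minn N #|cls l :\: S|); split.
- by move=> l; apply: geq_minl.
- move=> q w _ wL le PH.
  have [||f [fE fS]] := @word_embedding S q w => //; last exact: frS fE fS PH.
  by move=> l /le; rewrite leq_min => /andP[].
- apply: leq_trans leS.
  apply: (@leq_trans (\sum_(0 <= l < L) #|cls l :&: S|)).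
    apply: leq_sum => l _; have := cardsID S (cls l).
    by rewrite /minn; case: ifP; case: ltnP; lia.
  rewrite (eq_bigr (fun l => \sum_(x in S) (lab x == l))); last first.
    move=> l _; rewrite -sum1_card [RHS]big_mkcond [LHS]big_mkcond /=.
    by apply: eq_bigr => x _; rewrite !inE andbC; do 2?case: ifP => //; case: eqP.
  rewrite exchange_big /= -sum1_card; apply: leq_sum => x _.
  rewrite big_mkord (bigD1 (Ordinal (lab_lt x))) //= eqxx big1 // => l ne.
  by move: ne; rewrite -val_eqE /= eq_sym => /negbTE ->.
Qed.

(** In each class with [r l < N], all vertices but the first [r l] are deleted. A member of the
    class of graphs in the rest would contain a minimal one, whose labels along an enumeration form
    a word excluded by [allowed]. *)
Lemma allowed_deletion k r :
  (forall l, l < L -> r l <= N) -> allowed r -> deletion_cost r <= k ->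
  free_deletion Pi G k.
Proof.
move=> leN okr le_k; pose keep l := take (r l) (enum (cls l)).
pose S := [set x | (r (lab x) < N) && (x \notin keep (lab x))].
exists S; split; last first.
  apply/(free_of_remove PiC) => H0 f0 f0E f0S /(minimal_embedding)[K [g [gE minK]]].
  pose f := f0 \o g; have [fI fE] : embedding f by apply: embedding_comp.
  have leK : #|K| <= N by apply: minimal_le minK; split; [exact: fI|].
  pose w i := if insub i is Some o then lab (f (enum_val (o : 'I_#|K|))) else 0.
  have wE (o : 'I_#|K|) : w o = lab (f (enum_val o)).
    by rewrite /w insubT // => lto; congr (lab (f (enum_val _))); apply: val_inj.
  apply: (okr #|K| w leK).
  - by move=> i lti; rewrite (wE (Ordinal lti)).
  - move=> l ltl; rewrite /letter_count big_mkord.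
    under eq_bigr => i _ do rewrite wE.
    have -> : \sum_(i < #|K|) (lab (f (enum_val i)) == l) =
        #|[set x : K | lab (f x) == l]|.
      rewrite -sum1_card [RHS]big_mkcond /= [RHS](reindex (@enum_val _ K)) /=; last first.
        by apply: onW_bij; apply: enum_val_bij.
      by apply: eq_bigr => i _; rewrite !inE; case: eqP.
    (* A class that is kept entirely sets no limit, since [K] has at most [N] vertices. *)
    have [ltN|geN] := ltnP (r l) N; last first.
      by apply: leq_trans (max_card _) _; apply: leq_trans leK geN.
    rewrite -(card_imset _ fI); apply: (@leq_trans #|[set x in keep l]|).
      apply/subset_leq_card/subsetP => _ /imsetP[x + ->]; rewrite !inE => /eqP lx.
      by have := f0S (g x); rewrite inE -/(f x) lx ltN /= negbK.
    rewrite cardsE; apply: leq_trans (card_size _) _.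
    by rewrite size_take; case: ltnP.
  - case: minK => PK _; apply: PiC PK; apply: isomorphic_sym.
    exists (@enum_val _ K : word_graph e #|K| w -> K); first exact: enum_val_bij.
    move=> i j; rewrite /= /word_adj !wE -fE; have [->|ne] := eqVneq i j.
      exact: adj_irr.
    by rewrite adj_lab // (inj_eq fI) (inj_eq enum_val_inj).
apply: leq_trans le_k.
have -> : #|S| = \sum_(0 <= l < L) #|S :&: cls l|.
  rewrite (eq_bigr (fun l => \sum_(x in S) (lab x == l))); last first.
    move=> l _; rewrite -sum1_card [RHS]big_mkcond [LHS]big_mkcond /=.
    by apply: eq_bigr => x _; rewrite !inE; do 2?case: ifP => //; case: eqP.
  rewrite exchange_big /= -sum1_card; apply: eq_bigr => x _.
  rewrite big_mkord (bigD1 (Ordinal (lab_lt x))) //= eqxx big1 // => l ne.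
  by move: ne; rewrite -val_eqE /= eq_sym => /negbTE ->.
apply: leq_sum => l _; have [ltN|geN] := ltnP (r l) N; last first.
  rewrite mul0n leqn0 cards_eq0; apply/eqP/setP=> x; rewrite !inE.
  by apply/negP=> /andP[/andP[lt _] /eqP eql]; rewrite eql in lt; lia.
rewrite mul1n [X in _ <= X - _]cardE -size_drop.
apply: leq_trans (card_size _).
apply/subset_leq_card/subsetP => x; rewrite !inE.
case/andP=> /andP[_ nk] /eqP lx; rewrite lx in nk.
have : x \in enum (cls l) by rewrite mem_enum inE lx.
by rewrite -{1}(cat_take_drop (r l) (enum (cls l))) mem_cat (negbTE nk).
Qed.

End Deletion.

(** * Digits and encodings *)

Lemma digit_lt b a i : 0 < b -> digit b a i < b.
Proof. by move=> b0; rewrite /digit ltn_mod. Qed.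

Lemma digit_ex b (f : nat -> nat) m : (forall i, i < m -> f i < b) ->
  exists2 a, a < b ^ m & forall i, i < m -> digit b a i = f i.
Proof.
elim: m => [_|m IHm ltf]; first by exists 0.
have [|a lta aP] := IHm; first by move=> i lti; apply: ltf; apply: ltnW.
have ltm := ltf m (leqnn _); have b0 : 0 < b by apply: leq_ltn_trans ltm.
exists (f m * b ^ m + a).
  rewrite expnS; apply: (@leq_trans ((f m).+1 * b ^ m)); first by rewrite mulSn; lia.
  by rewrite leq_mul2r ltm orbT.
move=> i; rewrite ltnS leq_eqVlt => /orP[/eqP->|lti].
  by rewrite /digit divnMDl ?expn_gt0 ?b0 // divn_small // addn0 modn_small.
rewrite -(aP _ lti) /digit.
have -> : b ^ m = b ^ (m - i.+1) * b * b ^ i by rewrite -expnSr -expnD; congr (b ^ _); lia.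
by rewrite !mulnA divnMDl ?expn_gt0 ?b0 // modnMDl.
Qed.

(** Programs handle vertices as their ranks in [enum G], the order in which [encode_graph] lists
    them; the value is false on numbers that are not ranks. *)
Definition adjn (G : sgraph) (u v : nat) : bool :=
  [exists x : G, [exists y : G,
    [&& enum_rank x == u :> nat, enum_rank y == v :> nat & adj x y]]].

Lemma adjnE (G : sgraph) (x y : G) : adjn G (enum_rank x) (enum_rank y) = adj x y.
Proof.
apply/existsP/idP => [[x' /existsP[y' /and3P[]]]|xy].
  by move=> /eqP/val_inj/enum_rank_inj -> /eqP/val_inj/enum_rank_inj ->.
by exists x; apply/existsP; exists y; rewrite !eqxx.
Qed.

Lemma enum_rank_ex (T : finType) u : u < #|T| -> exists x : T, enum_rank x = u :> nat.
Proof. by move=> ltu; exists (enum_val (Ordinal ltu)); rewrite enum_valK. Qed.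

Lemma nth_allpairs (T U V : Type) (x0 : T) (y0 : U) (z0 : V) (f : T -> U -> V) s t i j :
  i < size s -> j < size t ->
  nth z0 [seq f x y | x <- s, y <- t] (i * size t + j) = f (nth x0 s i) (nth y0 t j).
Proof.
elim: s i => //= x s IHs [|i] lti ltj; rewrite nth_cat size_map.
  by rewrite ltj (nth_map y0).
by rewrite mulSn -addnA addKn ifF ?IHs //; apply/negbTE; lia.
Qed.

Lemma nth_encode_graph (G : sgraph) w a :
  nth 2 (map nat_of_bool (encode_graph G ++ w)) a =
  let n := #|G| in
  if a < n then 1 else if a == n then 0 else
  if a < n + n * n + 1 then nat_of_bool (adjn G ((a - n - 1) %/ n) ((a - n - 1) %% n))
  else nth 2 (map nat_of_bool w) (a - (n + n * n + 1)).
Proof.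
set n := #|G|; rewrite /= /encode_graph -/n -catA map_cat nth_cat size_map size_nseq.
case: ltnP => [lta|lea]; first by rewrite map_nseq nth_nseq lta.
have [->|ne] := eqVneq a n; first by rewrite subnn.
have -> : a - n = (a - n - 1).+1 by lia.
rewrite /= map_cat nth_cat size_map size_allpairs -cardE -/n subn1 /=.
have -> : (a < n + n * n + 1) = ((a - n).-1 < n * n) by lia.
case: ltnP => [lt|le]; last by congr (nth _ _ _); lia.
rewrite (nth_map false) ?size_allpairs -?cardE //; congr (nat_of_bool _).
set b := (a - n).-1 in lt *; have n0 : 0 < n by case: (n) lt.
have ltd : b %/ n < n by rewrite ltn_divLR.
have ltm : b %% n < n by rewrite ltn_mod.
have [x xE] := enum_rank_ex ltd; have [y yE] := enum_rank_ex ltm.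
rewrite [in LHS](divn_eq b n) {2}/n cardE (nth_allpairs x y) -?cardE //.
by rewrite subSS subn0 -xE -yE adjnE !nth_enum_rank.
Qed.

Lemma adjn_word_graph e q w i j : i < q -> j < q ->
  adjn (word_graph e q w) i j = (i != j) && (e (w i) (w j) || e (w j) (w i)).
Proof.
move=> lti ltj; pose G := word_graph e q w.
have rk (k : 'I_q) : enum_rank (k : G) = k :> nat.
  by rewrite enum_rank_ord.
by have := @adjnE G (Ordinal lti) (Ordinal ltj); rewrite !rk /= => ->.
Qed.

(** * The test of an option *)

(* A label [t * D.+1 + i] codes the adjacency [t], as a set of bits, of a vertex to
   an ordered cover of at most [D] vertices, and the position [i] of the vertex in
   this cover, with [i = D] outside of the cover. *)
Definition label_adj (D : nat) : rel nat :=
  fun a b => digit 2 (a %/ D.+1) (b %% D.+1) == 1.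

Definition labels (D : nat) : nat := D.+1 * 2 ^ D.

Lemma labels_gt0 D : 0 < labels D.
Proof. by rewrite muln_gt0 expn_gt0. Qed.

Section Basic.
Variables (X : Type) (env : X -> seq nat).
Implicit Types A B : X -> nat.

Lemma computable_succ A : computable_in env A -> computable_in env (fun x => (A x).+1).
Proof.
move=> cA; apply: (@computable_ext _ _ (fun x => A x + 1)); first by move=> x; lia.
by apply: computable_add => //; apply: computable_const.
Qed.

Lemma computable_labels A : computable_in env A ->
  computable_in env (fun x => labels (A x)).
Proof.
move=> cA; apply: computable_mul; first exact: computable_succ.
by apply: computable_pow => //; apply: computable_const.
Qed.

Lemma computable_label_adj D A B : computable_in env D -> computable_in env A ->
  computable_in env B -> computable_in env (fun x => label_adj (D x) (A x) (B x)).
Proof.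
move=> cD cA cB; apply: computable_eq; last exact: computable_const.
apply: computable_digit => //; first exact: computable_const.
  by apply: computable_div => //; apply: computable_succ.
by apply: computable_mod => //; apply: computable_succ.
Qed.

End Basic.

Lemma word_graph_ext (Pi : sgraph -> Prop) e q w w' : graph_class Pi ->
  (forall i, i < q -> w i = w' i) ->
  Pi (word_graph e q w) -> Pi (word_graph e q w').
Proof.
move=> PiC eqw; apply: PiC; exists id; first by exists id.
by move=> i j; rewrite /= /word_adj !eqw.
Qed.

Section Allowed.
Variables (Pi : sgraph -> Prop) (a b : nat).
Hypotheses (PiC : graph_class Pi) (Pi_dec : decidable_class Pi) (b_gt0 : 0 < b).

(** The form in which the polynomial bound is used: computable, and monotone in [D], so that [D] may
    be the size of any cover instead of the least one. *)
Definition min_order (D : nat) : nat := a * b ^ D.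

(* An option is the number of vertices kept for each label, truncated at
   [min_order D], as digits in base [(min_order D).+1]. *)
Definition options (D : nat) : nat := (min_order D).+1 ^ labels D.

Lemma computable_min_order (X : Type) (env : X -> seq nat) A :
  computable_in env A -> computable_in env (fun x => min_order (A x)).
Proof.
move=> cA; apply: computable_mul; first exact: computable_const.
by apply: computable_pow => //; apply: computable_const.
Qed.

Lemma computable_options (X : Type) (env : X -> seq nat) A :
  computable_in env A -> computable_in env (fun x => options (A x)).
Proof.
move=> cA; apply: computable_pow => //; last exact: computable_labels.
exact/computable_succ/computable_min_order.
Qed.

Definition code_graph (D q w : nat) : sgraph :=
  word_graph (label_adj D) q (digit (labels D) w).

(** The procedure for the class runs on a virtual input: by [nth_encode_graph], each bit of the
    encoding is an arithmetic expression in the code of the graph. *)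
Lemma code_graph_decided (X : Type) (env : X -> seq nat) D Q W :
  computable_in env D -> computable_in env Q -> computable_in env W ->
  exists F : X -> nat, computable_in env F /\
    forall x, F x != 0 <-> Pi (code_graph (D x) (Q x) (W x)).
Proof.
move=> cD cQ cW; case: Pi_dec => c cP.
have [|F FP] := functional_choice (fun x v =>
  (exists M s, run (encode_graph (code_graph (D x) (Q x) (W x))) M c [::] s /\
     reg s 0 = v) /\
  (v != 0 <-> Pi (code_graph (D x) (Q x) (W x)))).
  move=> x; have [B [s ex sP]] := cP (code_graph (D x) (Q x) (W x)).
  have [M r] := exec_run ex.
  by exists (reg s 0); split=> //; exists M, s.
exists F; split=> [|x]; last by case: (FP x).
apply: (@computable_call _ _ c 0 [::]
  (fun x => encode_graph (code_graph (D x) (Q x) (W x)))) => //; last first.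
  by move=> x; case: (FP x).
pose G p := code_graph (D p.1) (Q p.1) (W p.1).
apply: (@computable_ext _ _ (fun p : X * nat =>
  if p.2 < Q p.1 then 1 else if p.2 == Q p.1 then 0 else
  if p.2 < Q p.1 + Q p.1 * Q p.1 + 1 then
    let i := (p.2 - Q p.1 - 1) %/ Q p.1 in
    let j := (p.2 - Q p.1 - 1) %% Q p.1 in
    let u := digit (labels (D p.1)) (W p.1) i in
    let v := digit (labels (D p.1)) (W p.1) j in
    nat_of_bool (~~ (i == j) && (label_adj (D p.1) u v || label_adj (D p.1) v u))
  else 2)).
  move=> [x d] /=; rewrite -[encode_graph _]cats0 nth_encode_graph /= card_ord.
  set q := Q x; case: ifP => // geq; case: ifP => // neq.
  rewrite nth_nil; case: ifP => // ltd; congr nat_of_bool.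
  have q0 : 0 < q by case: (q) ltd neq; lia.
  rewrite adjn_word_graph // ?ltn_mod // ltn_divLR //.
  by move/eqP: neq; lia.
have cD' := computable_up cD; have cQ' := computable_up cQ; have cW' := computable_up cW.
have c1 := @computable_const (X * nat) (fun p => p.2 :: env p.1).
have cd := @computable_top X env.
have ce : computable_in (fun p : X * nat => p.2 :: env p.1)
    (fun p => p.2 - Q p.1 - 1).
  by apply: computable_sub => //; apply: computable_sub.
have ci := computable_div ce cQ'; have cj := computable_mod ce cQ'.
have cL := computable_labels cD'.
have cu := computable_digit (fun _ => labels_gt0 _) cL cW' ci.
have cv := computable_digit (fun _ => labels_gt0 _) cL cW' cj.
apply: computable_if => //; first exact: computable_lt.
apply: computable_if => //; first exact: computable_eq.
apply: computable_if => //.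
  apply: computable_lt => //; apply: computable_add => //; apply: computable_add => //.
  exact: computable_mul.
apply: computable_and; first by apply: computable_not; apply: computable_eq.
by apply: computable_or; apply: computable_label_adj.
Qed.

(** The quantifier over words becomes a finite sum over their codes: [bad] counts the pairs of a
    length and a code that respect the option and give a graph of the class. *)
Lemma allowed_computable : exists V : nat -> nat -> bool,
  computable_in env2 (fun p => V p.1 p.2) /\
  forall D r, V D r <->
    allowed Pi (labels D) (min_order D) (label_adj D) (digit (min_order D).+1 r).
Proof.
(* The components are [D], the option [r], the length [q] and the code [w] of a word. *)
pose Y : Type := nat * nat * nat * nat.
pose envY (y : Y) := y.2 :: y.1.2 :: env2 y.1.1.
have cW : computable_in envY (fun y => y.2) by apply: (@computable_var _ _ 0).
have cQ : computable_in envY (fun y => y.1.2) by apply: (@computable_var _ _ 1).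
have cD : computable_in envY (fun y => y.1.1.1) by apply: (@computable_var _ _ 2).
have cR : computable_in envY (fun y => y.1.1.2) by apply: (@computable_var _ _ 3).
have [F [cF FP]] := code_graph_decided cD cQ cW.
pose excess D r q w := \sum_(0 <= l < labels D)
  ~~ (letter_count (digit (labels D) w) q l <= digit (min_order D).+1 r l).
pose bad D r := \sum_(0 <= q < (min_order D).+1)
  \sum_(0 <= w < labels D ^ min_order D)
     ((excess D r q w == 0) && (0 < F (D, r, q, w))).
exists (fun D r => bad D r == 0); split.
  apply: computable_eq; last exact: computable_const.
  have cD0 : computable_in env2 (fun p => p.1) by apply: (@computable_var _ _ 0).
  apply: computable_sum; first exact/computable_succ/computable_min_order.
  apply: computable_sum; first (apply: computable_pow).
  - by move=> p; apply: labels_gt0.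
  - exact/computable_labels/(computable_up cD0).
  - exact/computable_min_order/(computable_up cD0).
  apply: computable_and; last first.
    apply: computable_lt; first exact: computable_const.
    by apply: computable_ext cF => -[[[D r] q] w].
  apply: computable_eq; last exact: computable_const.
  apply: computable_sum; first exact: computable_labels.
  apply/computable_not/computable_leq; last first.
    apply: computable_digit => //; last exact: (@computable_top Y envY).
      by apply: computable_succ; apply: computable_min_order; apply: (computable_up cD).
    exact: (computable_up cR).
  apply: computable_sum; first exact: (computable_up cQ).
  apply: computable_eq; last exact: computable_up (@computable_top Y envY).
  apply: computable_digit; last exact: (@computable_top _ (fun p : Y * nat => p.2 :: envY p.1)).
  - by move=> p; apply: labels_gt0.
  - by apply: computable_labels; apply: (computable_up (computable_up cD)).
  - exact: (computable_up (computable_up cW)).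
move=> D r; rewrite /bad; split=> [/eqP bad0 q w leq wL le PH|okr].
  (* The word is padded with 0 to the length [min_order D], so that one range of codes serves all
     lengths. *)
  have [|c ltc cP] := @digit_ex (labels D) (fun i => if i < q then w i else 0) (min_order D).
    by move=> i _; case: ifP => [/wL//|_]; apply: labels_gt0.
  have cw i : i < q -> w i = digit (labels D) c i.
    by move=> lti; rewrite cP ?lti //; apply: leq_trans leq.
  have t1 := leq_sum_term (fun q => \sum_(0 <= w < labels D ^ min_order D)
     ((excess D r q w == 0) && (0 < F (D, r, q, w)))) (_ : q < (min_order D).+1).
  have {t1} := t1 leq; rewrite bad0 leqNgt => /negP; apply.
  apply: (leq_trans _ (leq_sum_term _ ltc)) => /=.
  have -> : 0 < F (D, r, q, c).
    by rewrite lt0n; apply/FP; apply: word_graph_ext PH.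
  rewrite andbT /excess big_nat big1 ?eqxx // => l /andP[_ ltl].
  suff -> : letter_count (digit (labels D) c) q l = letter_count w q l by rewrite le.
  by apply: eq_big_nat => i /andP[_ lti]; rewrite cw.
rewrite big_nat big1 // => q /andP[_ leq]; rewrite big_nat big1 // => w _.
apply/eqP; rewrite eqb0; apply/negP=> /andP[ex0].
rewrite lt0n => /FP; apply: okr => //.
  by move=> i _; apply: digit_lt; apply: labels_gt0.
move=> l ltl; rewrite -[_ <= _]negbK; apply/negP=> nle.
have := leq_sum_term (fun l => nat_of_bool (~~
  (letter_count (digit (labels D) w) q l <= digit (min_order D).+1 r l))) ltl.
by rewrite -/(excess D r q w) (eqP ex0) nle.
Qed.

End Allowed.

(** * Labelling the vertices of a graph by a vertex cover *)

(** An element of [c] owns the bit numbered by its rank in [c]. Different elements own different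
    bits, so the sum has no carries and stays below the next power of 2. *)
Lemma sum_bits_lt (b c : nat -> bool) m :
  \sum_(0 <= u < m) (b u && c u) * 2 ^ (\sum_(0 <= v < u) c v) <
    2 ^ (\sum_(0 <= u < m) c u).
Proof.
elim: m => [|m IHm]; first by rewrite !big_geq.
rewrite !big_nat_recr //= expnD; set I := 2 ^ _ in IHm *.
by case: (b m); case: (c m) => /=; lia.
Qed.

Lemma digit_sum_bits (b c : nat -> bool) m u : u < m -> c u ->
  digit 2 (\sum_(0 <= v < m) (b v && c v) * 2 ^ (\sum_(0 <= v' < v) c v'))
    (\sum_(0 <= v < u) c v) = b u.
Proof.
elim: m => // m IHm; rewrite ltnS leq_eqVlt big_nat_recr //= => /orP[/eqP-> cm|ltu cu].
  rewrite cm andbT addnC /digit divnMDl ?expn_gt0 // divn_small ?sum_bits_lt //.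
  by rewrite addn0; case: (b m).
rewrite -(IHm ltu cu) /digit; set I := \sum_(0 <= v < u) _.
have lt : I < \sum_(0 <= v < m) c v.
  by rewrite [X in _ < X](big_cat_nat (n := u.+1)) //= big_nat_recr //= cu -/I; lia.
have -> : 2 ^ (\sum_(0 <= v < m) c v) = 2 ^ (\sum_(0 <= v < m) c v - I.+1) * 2 * 2 ^ I.
  by rewrite -expnSr -expnD; congr (2 ^ _); lia.
by rewrite addnC !mulnA divnMDl ?expn_gt0 // modnMDl.
Qed.

Lemma digit_small b a i : a < b ^ i -> digit b a i = 0.
Proof. by move=> lt; rewrite /digit divn_small // mod0n. Qed.

Section Cover.
Variable G : sgraph.
Let n := #|G|.

Definition degn (u : nat) : nat := \sum_(0 <= v < n) adjn G u v.

Definition in_cover (d v : nat) : bool :=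
  (d < degn v) || (0 < \sum_(0 <= u < n) (adjn G v u && (degn u <= d))).

Definition cover_rank (d v : nat) : nat := \sum_(0 <= u < v) in_cover d u.

Lemma sum_enum_rank (f : nat -> nat) :
  \sum_(0 <= v < n) f v = \sum_(x : G) f (enum_rank x).
Proof.
rewrite big_mkord (reindex (@enum_rank G)) //=.
exact/onW_bij/enum_rank_bij.
Qed.

Lemma sum_pred (T : finType) (p : pred T) : \sum_(x : T) p x = #|[set x | p x]|.
Proof.
by rewrite -sum1_card [RHS]big_mkcond; apply: eq_bigr => x _; rewrite inE; case: (p x).
Qed.

Lemma degnE (x : G) : degn (enum_rank x) = #|[set y | adj x y]|.
Proof.
by rewrite /degn sum_enum_rank -sum_pred; apply: eq_bigr => y _; rewrite adjnE.
Qed.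

Lemma in_coverP d (x : G) : in_cover d (enum_rank x) =
  (d < #|[set y | adj x y]|) || [exists y, adj x y && (#|[set z | adj y z]| <= d)].
Proof.
rewrite /in_cover degnE; congr (_ || _); rewrite sum_enum_rank.
have -> : \sum_(y : G) (adjn G (enum_rank x) (enum_rank y) && (degn (enum_rank y) <= d))
    = \sum_(y : G) (adj x y && (#|[set z | adj y z]| <= d)).
  by apply: eq_bigr => y _; rewrite adjnE degnE.
rewrite sum_pred card_gt0; apply/set0Pn/existsP => -[y]; rewrite ?inE.
  by exists y.
by exists y; rewrite inE.
Qed.

Definition cover_set (d : nat) : {set G} := [set x | in_cover d (enum_rank x)].

Lemma card_cover_set d : #|cover_set d| = cover_rank d n.
Proof. by rewrite /cover_rank sum_enum_rank -sum_pred. Qed.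

(** If one end of an edge is not high, the other is the neighbour of a low vertex. This holds for
    every [d]; only the size of the cover depends on the choice. *)
Lemma cover_setP d : vertex_cover (cover_set d).
Proof.
apply/forallP=> x; apply/forallP=> y; apply/implyP=> xy; rewrite !inE !in_coverP.
case: (ltnP d #|[set z | adj x z]|) => //= lex.
apply/orP; right; apply/orP; right; apply/existsP; exists x.
by rewrite adj_sym xy.
Qed.

(* A vertex of degree above [d = #|C|] belongs to [C], and a neighbour outside of
   [C] of a vertex [u] of degree at most [d] has [u] in [C]. *)
Lemma cover_rank_vc : cover_rank (vc_number G) n <= vc_number G + vc_number G * vc_number G.
Proof.
have [C /forallP covC dC] := vc_number_ex G; rewrite -card_cover_set -dC.
have cov x y : adj x y -> (x \in C) || (y \in C).
  by move=> xy; have /forallP/(_ y)/implyP := covC x; apply.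
set d := #|C|; rewrite -(cardsID C); apply: leq_add.
  exact/subset_leq_card/subsetIr.
(* Count the pairs of an [x] outside of [C] and a low neighbour [u] of it in [C]: each [x] has at
   least one such [u], and each [u] at most [d] such [x]. *)
apply: (@leq_trans (\sum_(x in cover_set d :\: C)
   \sum_(u in C) (adj u x && (#|[set z | adj u z]| <= d)))).
  rewrite -sum1_card; apply: leq_sum => x; rewrite !inE in_coverP.
  case/andP=> xC /orP[|/existsP[u /andP[xu leu]]].
    rewrite ltnNge => /negP; case; apply/subset_leq_card/subsetP => y.
    by rewrite inE => /cov; rewrite (negbTE xC).
  have uC : u \in C by have := cov _ _ xu; rewrite (negbTE xC).
  by rewrite (bigD1 u) //= adj_sym xu leu.
rewrite exchange_big /= -sum_nat_const; apply: leq_sum => u _.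
have [leu|] := leqP #|[set z | adj u z]| d; last by rewrite big1 // => x _; rewrite andbF.
apply: leq_trans leu; rewrite -sum_pred [X in X <= _]big_mkcond /=.
by apply: leq_sum => x _; rewrite andbT; case: ifP.
Qed.

Lemma cover_index_ex : exists d, cover_rank d n <= d + d * d.
Proof. by exists (vc_number G); apply: cover_rank_vc. Qed.

(** The vertex cover number only witnesses that the search succeeds. Being the least solution, this
    index can be found by trying 0, 1, 2 and so on. *)
Definition cover_index : nat := ex_minn cover_index_ex.

Definition cover_bound : nat := cover_index + cover_index * cover_index.

Lemma cover_rank_le : cover_rank cover_index n <= cover_bound.
Proof. by rewrite /cover_bound /cover_index; case: ex_minnP. Qed.

Lemma cover_index_min d : d < cover_index -> ~~ (cover_rank d n <= d + d * d).
Proof.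
rewrite /cover_index; case: ex_minnP => m _ minm ltd.
by apply/negP=> /minm; lia.
Qed.

Lemma cover_index_vc : cover_index <= vc_number G.
Proof. by rewrite /cover_index; case: ex_minnP => m _; apply; apply: cover_rank_vc. Qed.

Lemma cover_index_order : cover_index <= n.
Proof.
apply: leq_trans cover_index_vc _; have [C _ <-] := vc_number_ex G.
exact: max_card.
Qed.

Lemma cover_rank_mono d u v : u <= v -> cover_rank d u <= cover_rank d v.
Proof. by move=> leuv; rewrite /cover_rank [X in _ <= X](big_cat_nat (n := u)) //= leq_addr. Qed.

Lemma cover_rank_bound u : u <= n -> cover_rank cover_index u <= cover_bound.
Proof. by move=> leu; apply: leq_trans cover_rank_le; apply: cover_rank_mono. Qed.

Definition nbr_code (v : nat) : nat :=
  \sum_(0 <= u < n)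
     (adjn G v u && in_cover cover_index u) * 2 ^ cover_rank cover_index u.

Definition cover_pos (v : nat) : nat :=
  if in_cover cover_index v then cover_rank cover_index v else cover_bound.

Definition label (v : nat) : nat := nbr_code v * cover_bound.+1 + cover_pos v.

Lemma nbr_code_lt v : nbr_code v < 2 ^ cover_bound.
Proof.
apply: leq_trans (sum_bits_lt (adjn G v) (in_cover cover_index) n) _.
by rewrite leq_pexp2l // cover_rank_le.
Qed.

Lemma cover_pos_le v : v < n -> cover_pos v <= cover_bound.
Proof.
move=> ltv; rewrite /cover_pos; case: ifP => // _.
exact/cover_rank_bound/ltnW.
Qed.

Lemma label_lt v : v < n -> label v < labels cover_bound.
Proof.
move=> ltv; rewrite /label /labels mulnC.
have := nbr_code_lt v; have := cover_pos_le ltv.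
move: (2 ^ _) (nbr_code v) (cover_pos v) => p u q; nia.
Qed.

Lemma label_adjE u v : u < n -> v < n ->
  label_adj cover_bound (label u) (label v) = in_cover cover_index v && adjn G u v.
Proof.
move=> ltu ltv; rewrite /label_adj /label divnMDl // divn_small ?ltnS ?cover_pos_le //.
rewrite addn0 modnMDl modn_small ?ltnS ?cover_pos_le // /cover_pos.
(* Outside of the cover the position is [cover_bound], where every neighbourhood code has digit 0,
   so no adjacency is reported. *)
case: ifP => cv; last by rewrite digit_small // nbr_code_lt.
by rewrite /nbr_code /cover_rank digit_sum_bits //; case: (adjn _ _ _).
Qed.

(** Every edge has an end in the cover, and its position is found in the neighbourhood code of the
    other end; which end it is cannot be foreseen, hence the disjunction. *)
Lemma adj_label (x y : G) : adj x y =
  label_adj cover_bound (label (enum_rank x)) (label (enum_rank y)) ||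
  label_adj cover_bound (label (enum_rank y)) (label (enum_rank x)).
Proof.
rewrite !label_adjE // !adjnE [adj y x]adj_sym -andb_orl.
case xy: (adj x y); rewrite ?andbF ?andbT //.
have /forallP/(_ x)/forallP/(_ y) := cover_setP cover_index.
by rewrite xy !inE /= orbC => ->.
Qed.

End Cover.

(** * The answer as a sum over options *)

Lemma sum_bool_neq0 n (p : pred nat) :
  \sum_(0 <= i < n) p i != 0 <-> exists2 i, i < n & p i.
Proof.
split=> [nz|[i lti pi]]; last first.
  by have := leq_sum_term (fun j => nat_of_bool (p j)) lti; rewrite pi lt0n.
have [/hasP[i]|/hasPn none] := boolP (has p (iota 0 n)).
  by rewrite mem_iota => /andP[_ lti] pi; exists i.
case/negP: nz; rewrite big_nat big1 // => i /andP[_ lti].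
by apply/eqP; rewrite eqb0 none // mem_iota.
Qed.

Section Answer.
Variables (a b : nat) (V : nat -> nat -> bool).

Definition label_count (G : sgraph) (l : nat) : nat :=
  \sum_(0 <= v < #|G|) (label G v == l).

Definition option_cost (G : sgraph) (r : nat) : nat :=
  \sum_(0 <= l < labels (cover_bound G))
     (digit (min_order a b (cover_bound G)).+1 r l < min_order a b (cover_bound G)) *
     (label_count G l - digit (min_order a b (cover_bound G)).+1 r l).

(** Capping the budget at [#|G|] changes nothing since no option costs more, while [k], given in
    binary, may be too large to be stored. *)
Definition answer (G : sgraph) (k : nat) : nat :=
  \sum_(0 <= r < options a b (cover_bound G))
     (V (cover_bound G) r && (option_cost G r <= minn #|G| k)).

Lemma label_countE (G : sgraph) l :
  label_count G l = #|[set x : G | label G (enum_rank x) == l]|.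
Proof. by rewrite /label_count sum_enum_rank sum_pred. Qed.

Lemma sum_label_count (G : sgraph) m : \sum_(0 <= l < m) label_count G l <= #|G|.
Proof.
rewrite exchange_big_nat /= -[X in _ <= X]muln1 -[X in X * 1]subn0 -sum_nat_const_nat.
apply: leq_sum => v _; elim: m => [|m IHm]; first by rewrite big_geq.
rewrite big_nat_recr //=; case: eqP => [eqv|_]; last by rewrite addn0.
by rewrite big_nat big1 // => l /andP[_ ltl]; apply/eqP; rewrite eqb0 eqv; lia.
Qed.

Lemma option_cost_le (G : sgraph) r : option_cost G r <= #|G|.
Proof.
apply: leq_trans (sum_label_count G _); apply: leq_sum => l _.
by case: (_ < _); lia.
Qed.

Variable Pi : sgraph -> Prop.
Hypotheses (PiC : graph_class Pi) (b_gt0 : 0 < b).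
Hypothesis minimal_order_le : forall K : sgraph,
  vertex_minimal Pi K -> #|K| <= a * b ^ vc_number K.
Hypothesis VP : forall D r, V D r <->
  allowed Pi (labels D) (min_order a b D) (label_adj D)
    (digit (min_order a b D).+1 r).

Lemma answerP (G : sgraph) k : answer G k != 0 <-> free_deletion Pi G k.
Proof.
set D := cover_bound G; set L := labels D; set N := min_order a b D.
pose lab (x : G) := label G (enum_rank x).
have lab_lt x : lab x < L by apply: label_lt.
have adj_lab (x y : G) : x != y -> adj x y =
    label_adj D (lab x) (lab y) || label_adj D (lab y) (lab x).
  by move=> _; apply: adj_label.
(* The computed cover restricts to a cover of [K], so [D] can replace the vertex cover number of [K]
   in the bound on its order. *)
have minN (K : sgraph) (f : K -> G) : embedding f -> vertex_minimal Pi K -> #|K| <= N.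
  move=> fE /minimal_order_le le; apply: leq_trans le _.
  rewrite leq_mul2l leq_pexp2l ?orbT //.
  apply: leq_trans (cover_rank_le G); rewrite -card_cover_set.
  exact: vc_number_embedding fE (cover_setP G _).
have costE r : option_cost G r = deletion_cost L N lab (digit N.+1 r).
  by apply: eq_bigr => l _; rewrite label_countE.
have le_min r : (option_cost G r <= minn #|G| k) = (option_cost G r <= k).
  by rewrite leq_min option_cost_le.
apply: iff_trans (sum_bool_neq0 _ _) _; split=> [[r _ /andP[/VP okr]]|].
  rewrite le_min costE => le_k.
  apply: (allowed_deletion PiC lab_lt adj_lab minN _ okr le_k) => l _.
  by rewrite -ltnS; apply: digit_lt.
case/(deletion_allowed N PiC lab_lt adj_lab) => [r [leN okr le_k]].
have [|c ltc cP] := @digit_ex N.+1 r L; first by move=> l _; rewrite ltnS.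
exists c => //; apply/andP; split.
  apply/VP => q w leq wL le; apply: okr => // l ltl.
  by rewrite -(cP _ ltl); apply: le.
rewrite le_min costE; apply: leq_trans le_k; rewrite /deletion_cost !big_nat.
by apply: leq_sum => l /andP[_ ltl]; rewrite cP.
Qed.

End Answer.

(** Horner's scheme commutes with truncation: once [c] reaches [n], so does [2 * c] plus a bit. *)
Lemma minn_iteri n k m : k < 2 ^ m ->
  iteri m (fun i c => minn n (2 * c + odd (k %/ 2 ^ (m - i.+1)))) 0 = minn n k.
Proof.
move=> ltk; set F := fun i c => _.
suff Fi i : i <= m -> iteri i F 0 = minn n (k %/ 2 ^ (m - i)).
  by rewrite Fi // subnn divn1.
elim: i => [_|i IHi ltim]; first by rewrite subn0 divn_small.
rewrite iteriS IHi 1?ltnW // /F.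
have -> : k %/ 2 ^ (m - i) = (k %/ 2 ^ (m - i.+1)) %/ 2.
  by rewrite -divnMA -expnSr; congr (_ %/ 2 ^ _); lia.
by set u := k %/ _; have := odd_double_half u; rewrite -divn2; lia.
Qed.

(** * The logarithmic-space program *)

Definition input (x : sgraph * nat) : seq bool := encode_graph x.1 ++ encode_nat x.2.

Lemma size_input x : size (input x) = #|x.1| + #|x.1| * #|x.1| + 1 + bitsize x.2.
Proof.
rewrite size_cat /encode_graph size_cat size_nseq /= size_allpairs -cardE size_mkseq.
by lia.
Qed.

Lemma nth_input x c : nth 2 (map nat_of_bool (input x)) c =
  let n := #|x.1| in
  if c < n then 1 else if c == n then 0 else
  if c < n + n * n + 1 then nat_of_bool (adjn x.1 ((c - n - 1) %/ n) ((c - n - 1) %% n))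
  else if c < size (input x) then nat_of_bool (odd (x.2 %/ 2 ^ (c - (n + n * n + 1)))) else 2.
Proof.
rewrite nth_encode_graph size_input /=; set n := #|x.1|.
case: ifP => // _; case: ifP => // _; case: ltnP => // le.
case: ltnP => lt; last by rewrite nth_default // size_map size_mkseq; lia.
rewrite (nth_map false) ?size_mkseq; last by lia.
by rewrite nth_mkseq //; lia.
Qed.

Section Options.
Variables (a b D : nat).
Hypotheses (a_gt0 : 0 < a) (b_gt0 : 0 < b).

(** Options are written with at least two digits since [a] and [b] are positive. Their number
    therefore dominates the other quantities defined from [D], and [M_options] covers them all. *)
Lemma labels_lt_options : labels D < options a b D.
Proof.
apply: leq_trans (ltn_expl _ (ltnSn 1)) _.
by rewrite leq_exp2r ?labels_gt0 // ltnS muln_gt0 a_gt0 expn_gt0 b_gt0.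
Qed.

Lemma digit_base_options l : l <= labels D ->
  (min_order a b D).+1 ^ l <= options a b D.
Proof. by move=> lel; rewrite leq_pexp2l. Qed.

Lemma min_order_lt_options : min_order a b D < options a b D.
Proof. by rewrite -[X in X <= _]expn1; apply: digit_base_options; apply: labels_gt0. Qed.

End Options.

Section Program.
Variables (a b : nat) (V : nat -> nat -> bool) (T : nat -> nat -> nat).
Variable Mx : sgraph * nat -> nat.
Hypotheses (a_gt0 : 0 < a) (b_gt0 : 0 < b).
Hypothesis VT : forall (X : Type) (P : X -> seq bool -> Prop) env M (A B : X -> nat),
  computes P env M A -> computes P env M B ->
  (forall x w, P x w -> T (A x) (B x) <= M x) ->
  computes P env M (fun x => V (A x) (B x)).
Hypothesis M_size : forall x, 2 * size (input x) + 2 <= Mx x.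
Hypothesis M_options : forall x, options a b (cover_bound x.1) <= Mx x.
Hypothesis M_T : forall x r, r < options a b (cover_bound x.1) ->
  T (cover_bound x.1) r <= Mx x.

Lemma M_bounds (x : sgraph * nat) (n := #|x.1|) (D := cover_bound x.1) :
  [/\ 2 < Mx x, 2 * n + 1 <= Mx x, n + n * n + 1 <= Mx x & D < Mx x] /\
  [/\ 2 ^ D < Mx x, labels D < Mx x & min_order a b D < Mx x].
Proof.
have := M_size x; rewrite size_input -/n => leM.
have lt1 : labels D < Mx x by apply: leq_trans (M_options x); apply: labels_lt_options.
have lt2 : min_order a b D < Mx x.
  by apply: leq_trans (M_options x); apply: min_order_lt_options.
have lt3 : D < labels D by rewrite /labels leq_pmulr // expn_gt0.
have lt4 : 2 ^ D <= labels D by rewrite /labels leq_pmull.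
by do !split; lia.
Qed.

Definition reads (X : Type) (P : X -> seq bool -> Prop) (g : X -> sgraph * nat) :=
  forall x w, P x w -> w = input (g x).

Local Notation Mg g := (fun x => Mx (g x)) (only parsing).

Lemma Mx_gt0 x : 0 < Mx x.
Proof. by have [[lt _ _ _] _] := M_bounds x; lia. Qed.
#[local] Hint Resolve Mx_gt0 : core.

Lemma reads_up (X : Type) (P : X -> seq bool -> Prop) g (Q : X * nat -> Prop) :
  reads P g -> reads (fun (p : X * nat) w => P p.1 w /\ Q p) (fun p => g p.1).
Proof. by move=> Pg p w [/Pg]. Qed.

Lemma computes_bit (X : Type) (P : X -> seq bool -> Prop) env g A :
  reads P g ->
  computes P env (Mg g) A ->
  computes P env (Mg g) (fun x => nth 2 (map nat_of_bool (input (g x))) (A x)).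
Proof.
move=> Pg cA; apply: computes_input cA _ => x w /Pg ->; split=> //.
apply: (@leq_trans 2); last by have [[lt _ _ _] _] := M_bounds (g x); rewrite ltnW.
by rewrite nth_input /=; do !case: ifP => // _; apply: leq_trans (leq_b1 _) _.
Qed.

Lemma computes_const2 (X : Type) (P : X -> seq bool -> Prop) env g m :
  m <= 2 -> computes P env (Mg g) (fun=> m).
Proof.
move=> le2; apply: computes_const => x w _; apply: leq_trans le2 _.
by have [[lt _ _ _] _] := M_bounds (g x); rewrite ltnW.
Qed.

Lemma computes_size (X : Type) (P : X -> seq bool -> Prop) env g :
  reads P g ->
  computes P env (Mg g) (fun x => size (input (g x))).
Proof.
(* The size is the first address at which the end marker 2 is read. *)
move=> Pg; pose p x c := nat_of_bool (nth 2 (map nat_of_bool (input (g x))) c == 2).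
apply: (@computes_mu _ _ _ _ p) => [x w Px|].
  have := M_size (g x); move=> leM; split; [lia|lia| |].
    by rewrite /p nth_default ?size_map.
  move=> i lti; rewrite /p (nth_map false) //; by case: (nth _ _ _).
have Pg1 : reads (fun (q : X * nat) w => P q.1 w /\ q.2 <= size (input (g q.1)))
    (fun q => g q.1) by move=> q w [/Pg].
apply: computes_eq => //.
- apply: computes_bit => //; apply: (@computes_top X env (Mg g)) => q w [_ le].
  by apply: leq_trans le _; have := M_size (g q.1); lia.
- apply: computes_const => q w _.
  by have [[lt _ _ _] _] := M_bounds (g q.1); rewrite ltnW.
Qed.

Lemma computes_order (X : Type) (P : X -> seq bool -> Prop) env g :
  reads P g ->
  computes P env (Mg g) (fun x => #|(g x).1|).
Proof.
move=> Pg; pose p x c := nat_of_bool (~~ (nth 2 (map nat_of_bool (input (g x))) c == 1)).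
apply: (@computes_mu _ _ _ _ p) => [x w Px|].
  have [[? ? ? _] _] := M_bounds (g x); rewrite /p; split; [lia|lia| |].
    by rewrite nth_input /= ltnn eqxx.
  by move=> i lti; rewrite nth_input /= lti.
have Pg1 : reads (fun (q : X * nat) w => P q.1 w /\ q.2 <= #|(g q.1).1|)
    (fun q => g q.1) by move=> q w [/Pg].
apply: computes_not => //; apply: computes_eq => //.
- apply: computes_bit => //; apply: (@computes_top X env (Mg g)) => q w [_ le].
  by apply: leq_trans le _; have [[? ? ? _] _] := M_bounds (g q.1); lia.
- exact: computes_const.
Qed.

Lemma computes_adjn (X : Type) (P : X -> seq bool -> Prop) env g A B :
  reads P g ->
  computes P env (Mg g) A -> computes P env (Mg g) B ->
  (forall x w, P x w -> A x < #|(g x).1| /\ B x < #|(g x).1|) ->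
  computes P env (Mg g) (fun x => adjn (g x).1 (A x) (B x)).
Proof.
move=> Pg cA cB ltn; pose n x := #|(g x).1|.
have le x w : P x w -> n x + A x * n x + B x + 1 <= n x + n x * n x.
  by case/ltn; rewrite -/(n x); nia.
have leM x w : P x w -> n x + A x * n x + B x + 1 <= Mx (g x).
  move=> Px; apply: leq_trans (le _ _ Px) _.
  by have [[? ? ? _] _] := M_bounds (g x); rewrite /n; lia.
apply: (@computes_ext _ _ _ _ (fun x => nth 2 (map nat_of_bool (input (g x)))
    (n x + A x * n x + B x + 1))).
  move=> x w Px; have [ltA ltB] := ltn _ _ Px; have := le _ _ Px.
  rewrite nth_input /= -/(n x) => le'.
  rewrite ifF; last by apply/negbTE; lia.
  rewrite ifF; last by apply/negbTE; lia.
  rewrite ifT; last by lia.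
  have -> : n x + A x * n x + B x + 1 - n x - 1 = A x * n x + B x by lia.
  by rewrite divnMDl ?modnMDl ?divn_small ?modn_small ?addn0 //; lia.
apply: computes_bit => //; apply: computes_add; last by move=> x w /leM.
  apply: computes_add => //; last by move=> x w /leM /=; lia.
  apply: computes_add; [exact: computes_order| |by move=> x w /leM /=; lia].
  by apply: computes_mul => //; [exact: computes_order|move=> x w /leM /=; lia].
by apply: computes_const => x w /leM /=; lia.
Qed.

Lemma computes_degn (X : Type) (P : X -> seq bool -> Prop) env g A :
  reads P g ->
  computes P env (Mg g) A ->
  (forall x w, P x w -> A x < #|(g x).1|) ->
  computes P env (Mg g) (fun x => degn (g x).1 (A x)).
Proof.
move=> Pg cA ltA; apply: computes_sum; first exact: computes_order.
- apply: (@computes_adjn _ _ _ (fun p => g p.1)); first exact: reads_up.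
  + by apply: (computes_up _ cA) => p w [].
  + by apply: (@computes_top X env (Mg g)) => p w [_ /andP[lt le]]; lia.
  + by move=> p w [/ltA ? /andP[]].
- move=> x w Px; apply: leq_trans (sum_bool_le _ _) _.
  by have [[? ? ? _] _] := M_bounds (g x); lia.
Qed.

Lemma computes_in_cover (X : Type) (P : X -> seq bool -> Prop) env g d A :
  reads P g ->
  computes P env (Mg g) d ->
  computes P env (Mg g) A ->
  (forall x w, P x w -> A x < #|(g x).1|) ->
  computes P env (Mg g) (fun x => in_cover (g x).1 (d x) (A x)).
Proof.
move=> Pg cd cA ltA; have Pg1 Q := reads_up (Q := Q) Pg.
apply: computes_or => //; first by apply: computes_lt => //; apply: computes_degn.
apply: computes_gt0 => //; apply: computes_sum; first exact: computes_order.
- have ctop : computes (fun p w => P p.1 w /\ p.2 < #|(g p.1).1| <= Mx (g p.1))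
      (fun p => p.2 :: env p.1) (Mg (fun p => g p.1)) (fun p => p.2).
    by apply: (@computes_top X env (Mg g)) => p w [_ /andP[lt le]]; lia.
  apply: computes_and => //.
    apply: (@computes_adjn _ _ _ (fun p => g p.1)) => //.
    + by apply: (computes_up _ cA) => p w [].
    + by move=> p w [/ltA ? /andP[]].
  apply: computes_leq => //; last by apply: (computes_up _ cd) => p w [].
  by apply: (@computes_degn _ _ _ (fun p => g p.1)) => // p w [_ /andP[]].
- move=> x w Px; apply: leq_trans (sum_bool_le _ _) _.
  by have [[? ? ? _] _] := M_bounds (g x); lia.
Qed.

Lemma computes_cover_rank (X : Type) (P : X -> seq bool -> Prop) env g d A :
  reads P g ->
  computes P env (Mg g) d ->
  computes P env (Mg g) A ->
  (forall x w, P x w -> A x <= #|(g x).1|) ->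
  computes P env (Mg g) (fun x => cover_rank (g x).1 (d x) (A x)).
Proof.
move=> Pg cd cA ltA; have Pg1 Q := reads_up (Q := Q) Pg.
apply: computes_sum => //.
- apply: (@computes_in_cover _ _ _ (fun p => g p.1)) => //.
  + by apply: (computes_up _ cd) => p w [].
  + by apply: (@computes_top X env (Mg g)) => p w [_ /andP[lt le]]; lia.
  + by move=> p w [/ltA le /andP[]]; lia.
- move=> x w Px; apply: leq_trans (sum_bool_le _ _) _.
  by have := ltA _ _ Px; have [[? ? ? _] _] := M_bounds (g x); lia.
Qed.

Lemma computes_cover_index (X : Type) (P : X -> seq bool -> Prop) env g :
  reads P g ->
  computes P env (Mg g) (fun x => cover_index (g x).1).
Proof.
move=> Pg; have Pg1 Q := reads_up (Q := Q) Pg.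
pose p x i := nat_of_bool (cover_rank (g x).1 i #|(g x).1| <= i + i * i).
have le_n x := cover_index_order (g x).1.
apply: (@computes_mu _ _ _ _ p) => [x w Px|].
  have [[? ? ? _] _] := M_bounds (g x); split; [lia|have := le_n x; lia| |].
    by rewrite /p cover_rank_le.
  by move=> i lti; rewrite /p; apply/eqP; rewrite eqb0; apply: cover_index_min.
have ctop : computes (fun q w => P q.1 w /\ q.2 <= cover_index (g q.1).1)
    (fun q => q.2 :: env q.1) (fun q => Mx (g q.1)) (fun q => q.2).
  apply: (@computes_top X env (Mg g)) => q w [_ le].
  by have := le_n q.1; have [[? ? ? _] _] := M_bounds (g q.1); lia.
have leM q w : P q.1 w /\ q.2 <= cover_index (g q.1).1 ->
    q.2 + q.2 * q.2 <= Mx (g q.1).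
  by case=> _; have := le_n q.1; have [[? ? ? _] _] := M_bounds (g q.1); nia.
apply: computes_leq => //.
- apply: (@computes_cover_rank _ _ _ (fun q => g q.1)) => //.
  exact: (@computes_order _ _ _ (fun q => g q.1)).
- apply: computes_add => //; apply: computes_mul => // q w /leM; lia.
Qed.

Lemma computes_cover_bound (X : Type) (P : X -> seq bool -> Prop) env g :
  reads P g ->
  computes P env (Mg g) (fun x => cover_bound (g x).1).
Proof.
move=> Pg; have c := @computes_cover_index _ _ env _ Pg.
have le x w : P x w -> cover_bound (g x).1 <= Mx (g x).
  by move=> _; have [[? ? ? ?] _] := M_bounds (g x); rewrite ltnW.
apply: computes_add => //; apply: computes_mul => // x w /le; rewrite /cover_bound; lia.
Qed.

Lemma computes_nbr_code (X : Type) (P : X -> seq bool -> Prop) env g A :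
  reads P g ->
  computes P env (Mg g) A ->
  (forall x w, P x w -> A x < #|(g x).1|) ->
  computes P env (Mg g) (fun x => nbr_code (g x).1 (A x)).
Proof.
move=> Pg cA ltA; have Pg1 Q := reads_up (Q := Q) Pg.
apply: computes_sum; first exact: computes_order.
- have ctop : computes (fun p w => P p.1 w /\ p.2 < #|(g p.1).1| <= Mx (g p.1))
      (fun p => p.2 :: env p.1) (Mg (fun p => g p.1)) (fun p => p.2).
    by apply: (@computes_top X env (Mg g)) => p w [_ /andP[lt le]]; lia.
  have cdi : computes (fun p w => P p.1 w /\ p.2 < #|(g p.1).1| <= Mx (g p.1))
      (fun p => p.2 :: env p.1) (Mg (fun p => g p.1)) (fun p => cover_index (g p.1).1).
    exact: (@computes_cover_index _ _ _ (fun p => g p.1)).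
  have le2 p w : P p.1 w /\ p.2 < #|(g p.1).1| <= Mx (g p.1) ->
      2 ^ cover_rank (g p.1).1 (cover_index (g p.1).1) p.2 <= Mx (g p.1).
    case=> _ /andP[lt _]; have [_ [le _ _]] := M_bounds (g p.1).
    apply: leq_trans (ltnW le); rewrite leq_exp2l //.
    exact/cover_rank_bound/ltnW.
  apply: computes_mul.
  + apply: computes_and => //.
      apply: (@computes_adjn _ _ _ (fun p => g p.1)) => //.
        by apply: (computes_up _ cA) => p w [].
      by move=> p w [/ltA ? /andP[]].
    apply: (@computes_in_cover _ _ _ (fun p => g p.1)) => //.
    by move=> p w [_ /andP[]].
  + apply: computes_pow; last by move=> p w /le2.
      exact: (@computes_const2 _ _ _ (fun p => g p.1)).
    apply: (@computes_cover_rank _ _ _ (fun p => g p.1)) => //.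
    by move=> p w [_ /andP[/ltnW]].
  + by move=> p w /le2; case: (_ && _); lia.
- move=> x w Px; have [_ [le _ _]] := M_bounds (g x).
  by apply: leq_trans (ltnW le); apply/ltnW/nbr_code_lt.
Qed.

Lemma computes_label (X : Type) (P : X -> seq bool -> Prop) env g A :
  reads P g ->
  computes P env (Mg g) A ->
  (forall x w, P x w -> A x < #|(g x).1|) ->
  computes P env (Mg g) (fun x => label (g x).1 (A x)).
Proof.
move=> Pg cA ltA; have cD := @computes_cover_bound _ _ env _ Pg.
have ci := @computes_cover_index _ _ env _ Pg.
have leM x w : P x w -> nbr_code (g x).1 (A x) * (cover_bound (g x).1).+1 +
    cover_pos (g x).1 (A x) <= Mx (g x).
  move=> Px; have [_ [_ le _]] := M_bounds (g x).
  by apply: leq_trans (ltnW le); apply/ltnW/label_lt/ltA/Px.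
apply: computes_add => //.
- apply: computes_mul; [exact: computes_nbr_code| |].
    apply: (@computes_ext _ _ _ _ (fun x => cover_bound (g x).1 + 1)).
      by move=> x w _; rewrite addn1.
    apply: computes_add => //; first exact: computes_const2.
    by move=> x w _; have [[_ _ _ ?] _] := M_bounds (g x); lia.
  by move=> x w /leM; apply: leq_trans; apply: leq_addr.
- apply: computes_if => //; first exact: computes_in_cover.
  by apply: computes_cover_rank => // x w /ltA /ltnW.
Qed.

Lemma computes_label_count (X : Type) (P : X -> seq bool -> Prop) env g A :
  reads P g ->
  computes P env (Mg g) A ->
  computes P env (Mg g) (fun x => label_count (g x).1 (A x)).
Proof.
move=> Pg cA; have Pg1 Q := reads_up (Q := Q) Pg.
apply: computes_sum; first exact: computes_order.
- apply: computes_eq => //; last by apply: (computes_up _ cA) => p w [].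
  apply: (@computes_label _ _ _ (fun p => g p.1)) => //; last by move=> p w [_ /andP[]].
  by apply: (@computes_top X env (Mg g)) => p w [_ /andP[lt le]]; lia.
- move=> x w Px; apply: leq_trans (sum_bool_le _ _) _.
  by have [[? ? ? _] _] := M_bounds (g x); lia.
Qed.

Lemma computes_labels (X : Type) (P : X -> seq bool -> Prop) env g :
  reads P g ->
  computes P env (Mg g) (fun x => labels (cover_bound (g x).1)).
Proof.
move=> Pg; have cD := @computes_cover_bound _ _ env _ Pg.
have le x := M_bounds (g x).
apply: computes_mul; last by move=> x w _; have [_ [_ ? _]] := le x; apply: ltnW.
  apply: (@computes_ext _ _ _ _ (fun x => cover_bound (g x).1 + 1)).
    by move=> x w _; rewrite addn1.
  apply: computes_add => //; first exact: computes_const2.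
  by move=> x w _; have [[_ _ _ ?] _] := le x; lia.
apply: computes_pow => //; first exact: computes_const2.
by move=> x w _; have [_ [lt2 _ _]] := le x; split=> //; apply: ltnW.
Qed.

Lemma computes_min_order (X : Type) (P : X -> seq bool -> Prop) env g :
  reads P g ->
  computes P env (Mg g) (fun x => min_order a b (cover_bound (g x).1)).
Proof.
move=> Pg; have cD := @computes_cover_bound _ _ env _ Pg.
have leM x w : P x w -> a * b ^ cover_bound (g x).1 <= Mx (g x).
  by move=> _; have [_ [_ _ ?]] := M_bounds (g x); apply: ltnW.
have bD x : 0 < b ^ cover_bound (g x).1 by rewrite expn_gt0 b_gt0.
apply: computes_mul => //.
  by apply: computes_const => x w /leM; apply: leq_trans; rewrite leq_pmulr.
case: (posnP (a * b)); first by lia.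
(* When [cover_bound] is 0, the constant [b] may exceed the bound on values. It is loaded in the
   loop body only, which is not entered unless the exponent is positive. *)
move=> ab; apply: (@computes_ext _ _ _ _ (fun x =>
  iteri (cover_bound (g x).1) (fun _ c => c * b) 1)).
  by move=> x w _; rewrite -expn_iteri.
have lebM x j : j <= cover_bound (g x).1 -> forall w, P x w -> b ^ j <= Mx (g x).
  move=> lej w /leM; apply: leq_trans.
  by apply: leq_trans (leq_pmull _ a_gt0); rewrite leq_pexp2l.
apply: computes_fold => //; first exact: computes_const.
apply: computes_mul.
- by apply: (@computes_var _ _ _ _ 0) => p w [].
- apply: computes_const => p w [Pp /andP[lt _] _ _].
  by apply: leq_trans (lebM p.1.1 1 _ _ Pp); [rewrite expn1|lia].
- move=> [[x i] c] w /= [Px /andP[lt _] _ ->].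
  by rewrite -expn_iteri -expnSr; apply: lebM Px.
Qed.

Lemma computes_digit_base (X : Type) (P : X -> seq bool -> Prop) env g :
  reads P g ->
  computes P env (Mg g)
  (fun x => (min_order a b (cover_bound (g x).1)).+1).
Proof.
move=> Pg; apply: (@computes_ext _ _ _ _ (fun x => min_order a b (cover_bound (g x).1) + 1)).
  by move=> x w _; rewrite addn1.
apply: computes_add; [exact: computes_min_order|exact: computes_const2|].
by move=> x w _; have [_ [_ _ ?]] := M_bounds (g x); lia.
Qed.

Lemma computes_options (X : Type) (P : X -> seq bool -> Prop) env g :
  reads P g ->
  computes P env (Mg g) (fun x => options a b (cover_bound (g x).1)).
Proof.
move=> Pg; apply: computes_pow; [exact: computes_digit_base|exact: computes_labels|].
by move=> x w _; split=> //; apply: M_options.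
Qed.

Lemma computes_option_cost (X : Type) (P : X -> seq bool -> Prop) env g A :
  reads P g ->
  computes P env (Mg g) A ->
  computes P env (Mg g) (fun x => option_cost a b (g x).1 (A x)).
Proof.
move=> Pg cA.
apply: computes_sum; first exact: computes_labels.
- set P1 := (X in computes X); have Pg' : reads P1 (fun p => g p.1) by apply: reads_up.
  have ctop : computes P1 (fun p => p.2 :: env p.1) (Mg (fun p => g p.1)) (fun p => p.2).
    by apply: (@computes_top X env (Mg g)) => p w [_ /andP[lt le]]; lia.
  have cdig : computes P1 (fun p => p.2 :: env p.1) (Mg (fun p => g p.1))
      (fun p => digit (min_order a b (cover_bound (g p.1).1)).+1 (A p.1) p.2).
    apply: computes_digit => //.
    + exact: (@computes_digit_base _ _ _ (fun p => g p.1)).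
    + by apply: (computes_up _ cA) => p w [].
    + move=> p w [_ /andP[lt _]]; split=> //; apply: leq_trans (M_options _).
      exact/digit_base_options/ltnW.
  apply: (@computes_bin _ _ _ _ OpMul).
  + apply: computes_lt => //.
    exact: (@computes_min_order _ _ _ (fun p => g p.1)).
  + by apply: computes_sub => //; apply: (@computes_label_count _ _ _ (fun p => g p.1)).
  + by move=> p w _ _ /=; case: (_ < _); lia.
- move=> x w _; apply: leq_trans (option_cost_le _ _ _ _) _.
  by have [[? ? ? _] _] := M_bounds (g x); lia.
Qed.

(* The bits of the budget are read from the most significant one, truncating the
   value at [n] so that it fits in [O(log n)] bits. *)
Lemma computes_budget (X : Type) (P : X -> seq bool -> Prop) env g :
  reads P g ->
  computes P env (Mg g) (fun x => minn #|(g x).1| (g x).2).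
Proof.
move=> Pg; pose n x := #|(g x).1|; pose m x := bitsize (g x).2.
have szE x : size (input (g x)) = n x + n x * n x + 1 + m x by rewrite size_input.
apply: (@computes_ext _ _ _ _ (fun x => iteri (m x) (fun i c => minn (n x)
   (2 * c + odd ((g x).2 %/ 2 ^ (m x - i.+1)))) 0)).
  by move=> x w _; apply: minn_iteri; apply: up_logP.
have csz := @computes_size _ _ env _ Pg; have cn := @computes_order _ _ env _ Pg.
have cm : computes P env (Mg g) m.
  (* The budget is what remains of the input after the unary order, the separator and the matrix. *)
  apply: (@computes_ext _ _ _ _ (fun x => size (input (g x)) - n x - n x * n x - 1)).
    by move=> x w _; rewrite szE; lia.
  apply: computes_sub; last exact: computes_const2.
  apply: computes_sub; first exact: computes_sub.
  apply: computes_mul => // x w _.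
  by have [[? ? ? _] _] := M_bounds (g x); rewrite /n; lia.
apply: computes_fold => //; first exact: computes_const2.
set P1 := (X in computes X).
have Pg' : reads P1 (fun p => g p.1.1) by move=> p w [/Pg].
have ctop : computes P1 (fun p => [:: p.2, p.1.2 & env p.1.1]) (Mg (fun p => g p.1.1))
    (fun p => p.2) by apply: (@computes_var _ _ _ _ 0) => p w [].
have cidx : computes P1 (fun p => [:: p.2, p.1.2 & env p.1.1]) (Mg (fun p => g p.1.1))
    (fun p => p.1.2) by apply: (@computes_var _ _ _ _ 1) => p w [_ /andP[]]; split=> //; lia.
have cn1 : computes P1 (fun p => [:: p.2, p.1.2 & env p.1.1]) (Mg (fun p => g p.1.1))
    (fun p => n p.1.1) by apply: (@computes_order _ _ _ (fun p => g p.1.1)).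
have len p w : P1 p w -> p.2 <= n p.1.1.
  by case: p => [[x [|i]] c] [/= _ _ _ ->] //=; rewrite geq_minl.
have le2 p w : P1 p w -> 2 * p.2 + 1 <= Mx (g p.1.1).
  by move=> /len; have [[? ? ? _] _] := M_bounds (g p.1.1); rewrite /n; lia.
have c2 : computes P1 (fun p => [:: p.2, p.1.2 & env p.1.1]) (Mg (fun p => g p.1.1))
    (fun p => 2 * p.2 + nth 2 (map nat_of_bool (input (g p.1.1)))
       (size (input (g p.1.1)) - (p.1.2 + 1))).
  apply: computes_add.
  - apply: computes_mul => //; first exact: (@computes_const2 _ _ _ (fun p => g p.1.1)).
    by move=> p w /le2; lia.
  - apply: (@computes_bit _ _ _ (fun p => g p.1.1)) => //; apply: computes_sub.
      exact: (@computes_size _ _ _ (fun p => g p.1.1)).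
    apply: computes_add => //; first exact: (@computes_const2 _ _ _ (fun p => g p.1.1)).
    by move=> p w [_ /andP[]]; lia.
  - move=> p w Pp; apply: leq_trans (le2 _ _ Pp); rewrite leq_add2l.
    case: Pp => _ /andP[lt _] _ _; rewrite (nth_map false) ?leq_b1 //.
    by rewrite szE; lia.
apply: (@computes_ext _ _ _ _ (fun p => let v := 2 * p.2 +
    nth 2 (map nat_of_bool (input (g p.1.1))) (size (input (g p.1.1)) - (p.1.2 + 1)) in
    v - (v - n p.1.1))).
  move=> p w [_ /andP[lt _] _ _] /=; rewrite nth_input /= -/(n _) szE.
  do 3 (rewrite ifF; last by apply/negbTE; lia).
  rewrite ifT ?szE; last by lia.
  have -> : n p.1.1 + n p.1.1 * n p.1.1 + 1 + m p.1.1 - (p.1.2 + 1) -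
      (n p.1.1 + n p.1.1 * n p.1.1 + 1) = m p.1.1 - p.1.2.+1 by lia.
  by lia.
by apply: computes_sub => //; apply: computes_sub.
Qed.

Lemma computes_answer :
  computes (fun x w => w = input x) (fun=> [::]) Mx (fun x => answer a b V x.1 x.2).
Proof.
set P := fun _ _ => _.
have Pg : reads P id by [].
apply: computes_sum; first exact: (@computes_options _ _ _ id).
- set P1 := (X in computes X).
  have Pg1 : reads P1 (fun p => p.1) by move=> p w [].
  have ctop : computes P1 (fun p => [:: p.2]) (fun p => Mx p.1) (fun p => p.2).
    by apply: (@computes_top _ (fun=> [::]) Mx) => p w [_ /andP[lt le]]; lia.
  apply: computes_and; first by move=> p w [_ /andP[? ?]]; lia.
    apply: VT => //; first exact: (@computes_cover_bound _ _ _ fst).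
    by move=> p w [_ /andP[lt _]]; apply: M_T.
  apply: computes_leq; first by move=> p w [_ /andP[? ?]]; lia.
    exact: (@computes_option_cost _ _ _ fst).
  exact: (@computes_budget _ _ _ fst).
- by move=> x w _; apply: leq_trans (sum_bool_le _ _) (M_options _).
Qed.

End Program.

(** * The polynomial bound and the conclusion *)

Import Order.TTheory GRing.Theory Num.Theory.
Local Open Scope ring_scope.

(** For [i] below [size p], [m ^ i <= (2 ^ m) ^ i <= (2 ^ size p) ^ m], and the absolute values of
    the coefficients add up to at most some natural number. No real number is left, and [a] and [b]
    can be constants of a program. *)
Lemma horner_nat_le_exp (R : archiRealFieldType) (p : {poly R}) :
  exists a b : nat, [/\ (0 < a)%N, (0 < b)%N
    & forall m : nat, p.[m%:R] <= (a * b ^ m)%:R].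
Proof.
pose s := \sum_(i < size p) `|p`_i|.
have s0 : 0 <= s by apply: sumr_ge0.
exists (Num.bound s).+1, (2 ^ size p)%N; split=> // [|m]; first by rewrite expn_gt0.
rewrite horner_coef natrM; apply: (@le_trans _ _ (s * ((2 ^ size p) ^ m)%:R)).
  rewrite mulr_suml; apply: ler_sum => i _.
  apply: (le_trans (ler_norm _)); rewrite normrM -natrX normr_nat.
  apply: ler_wpM2l => //; rewrite ler_nat -expnM mulnC expnM.
  apply: (@leq_trans ((2 ^ m) ^ i)%N).
    by case: (nat_of_ord i) => // j; rewrite leq_exp2r // ltnW // ltn_expl.
  by rewrite leq_pexp2l ?expn_gt0 // ltnW.
apply: ler_wpM2r => //; apply: le_trans (ltW (archi_boundP s0)) _.
by rewrite ler_nat.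
Qed.

Lemma deletion_by_vc_para_L (Pi : sgraph -> Prop) (a b : nat) :
  graph_class Pi -> decidable_class Pi -> (0 < a)%N -> (0 < b)%N ->
  (forall G, vertex_minimal Pi G -> #|G| <= a * b ^ vc_number G)%N ->
  para_L (free_deletion_by_vc Pi).
Proof.
move=> PiC Pi_dec a0 b0 min_le.
have [V [cV VP]] := allowed_computable a PiC Pi_dec b0.
have [T [cT TP]] := @computable_cost (fun d r => nat_of_bool (V d r)) cV.
(* [cover_bound] is not a function of the parameter [k] but is at most [k + k * k]; summing over all
   [d] up to there, and over all options, covers whichever value occurs. *)
pose F0 k := (\sum_(0 <= d < k + k * k + 1)
  (options a b d + \sum_(0 <= r < options a b d) T d r))%N.
pose M x := (F0 (vc_number x.1) + 2 * size (input x) + 2)%N.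
have le_F0 (G : sgraph) (d := cover_bound G) :
    (options a b d + \sum_(0 <= r < options a b d) T d r <= F0 (vc_number G))%N.
  apply: (@leq_sum_term _ (fun d => _ + \sum_(0 <= r < _) T d r)%N).
  by rewrite /d /cover_bound; have := cover_index_vc G; nia.
apply: (@para_L_of_computes (free_deletion_by_vc Pi) M
  (fun x => answer a b V x.1 x.2) F0) => //; last first.
- by move=> x; apply: (answerP PiC b0 min_le VP).
- apply: (@computes_answer a b V T) => //.
  + by move=> x; rewrite /M; lia.
  + by move=> x; have := le_F0 x.1; rewrite /M; lia.
  + move=> x r ltr; have := le_F0 x.1.
    by have := leq_sum_term (fun r => T (cover_bound x.1) r) ltr; rewrite /M; lia.
have cid : computable_in (fun k => [:: k]) id by apply: (@computable_var _ _ 0).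
have c1 := @computable_const _ (fun k : nat => [:: k]) 1.
apply: computable_sum; first by do !apply: computable_add => //; apply: computable_mul.
have cd := @computable_top _ (fun k : nat => [:: k]).
apply: computable_add; first exact: computable_options.
apply: computable_sum; first exact: computable_options.
apply: (computable_app2 cT); first exact: (computable_up cd).
exact: (@computable_top _ (fun p : nat * nat => p.2 :: [:: p.1])).
Qed.

Theorem theorem4 (Pi : sgraph -> Prop) (c : nat)
    (R : archiRealFieldType) (p : {poly R}) :
  graph_class Pi ->
  decidable_class Pi ->
  (forall G : sgraph, Pi G -> (0 < #|G|)%N) ->
  characterized_by_adjacencies Pi c ->
  (forall m n : nat, (m <= n)%N -> p.[m%:R] <= p.[n%:R]) ->
  (forall G : sgraph, vertex_minimal Pi G -> #|G|%:R <= p.[(vc_number G)%:R]) ->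
  para_L (free_deletion_by_vc Pi).
Proof.
move=> PiC Pi_dec _ _ _ min_le; have [a [b [a0 b0 le_ab]]] := horner_nat_le_exp p.
apply: (deletion_by_vc_para_L PiC Pi_dec a0 b0) => G /min_le le.
by rewrite -(ler_nat R); apply: le_trans le (le_ab _).
Qed.
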